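(* Let $n\ge 1$ and $\mathfrak{g}=\mathfrak{gl}(n+1,\mathbb{C})$. Let $\Phi:\mathfrak{g}\to\mathbb{C}^{\binom{n+2}{2}}$ be $\Phi(x)=(f_{i,j}(x))_{1\le j\le i\le n+1}$ with $f_{i,j}(x)=\mathrm{Tr}(x_i^j)$, and let $\Phi^{-1}(0)_{sreg}=\Phi^{-1}(0,\dots,0)\cap\mathfrak{g}_{sreg}$. Consider the $2^n$ sequences $\mathcal{Q}=(Q_1,\dots,Q_{n+1})$ with $Q_i\in\{Q_{+,i},Q_{-,i}\}$ for each $i$ (where $Q_{+,1}=Q_{-,1}$). Then: (a) every $x\in\Phi^{-1}(0)_{sreg}$ lies in $\mathfrak{b}_{\mathcal{Q}}$ for some such sequence $\mathcal{Q}$; (b) $\Phi^{-1}(0)_{sreg}=\coprod_{\mathcal{Q}}\mathfrak{n}_{\mathcal{Q}}^{reg}$, the union being disjoint and taken over all $2^n$ such sequences, and this is the decomposition of the variety $\Phi^{-1}(0)_{sreg}$ into its irreducible components (each $\mathfrak{n}_{\mathcal{Q}}^{reg}$ is an irreducible component, and every irreducible component is of this form).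
   Context: For $1\le i\le n+1$, $\mathfrak{g}_i\cong\mathfrak{gl}(i,\mathbb{C})$ denotes the subalgebra of $\mathfrak{g}$ of matrices supported in the upper left $i\times i$ corner, and for $x\in\mathfrak{g}$, $x_i=\pi_i(x)\in\mathfrak{g}_i$ is obtained from $x$ by keeping the entries in the upper left $i\times i$ corner and setting all other entries to $0$; $x_i^j$ is its $j$-th power as an $i\times i$ matrix. An element $x\in\mathfrak{g}$ is strongly regular if the differentials $\{df_{i,j}(x):1\le j\le i\le n+1\}$ are linearly independent in $T_x^*\mathfrak{g}$; $\mathfrak{g}_{sreg}$ is the set of strongly regular elements. $\mathcal{B}_i$ is the flag variety of Borel subalgebras of $\mathfrak{g}_i$. $K_i=GL(i-1,\mathbb{C})\times GL(1,\mathbb{C})\subset GL(i,\mathbb{C})$ is the group of invertible block diagonal matrices with an $(i-1)\times(i-1)$ block and a $1\times 1$ block (the fixed points of conjugation by $\mathrm{diag}(1,\dots,1,-1)$), acting on $\mathcal{B}_i$ by conjugation. $Q_{+,i}$ (resp. $Q_{-,i}$) is the $K_i$-orbit in $\mathcal{B}_i$ of the Borel subalgebra of upper (resp. lower) triangular matrices in $\mathfrak{g}_i$. For such a sequence $\mathcal{Q}$ there is exactly one Borel subalgebra $\mathfrak{b}$ of $\mathfrak{g}$ such that $\pi_i(\mathfrak{b})$ is a Borel subalgebra of $\mathfrak{g}_i$ lying in $Q_i$ for all $i=1,\dots,n+1$; it is denoted $\mathfrak{b}_{\mathcal{Q}}$. Let $\mathfrak{n}_{\mathcal{Q}}=[\mathfrak{b}_{\mathcal{Q}},\mathfrak{b}_{\mathcal{Q}}]$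 and $\mathfrak{n}_{\mathcal{Q}}^{reg}$ the set of elements of $\mathfrak{n}_{\mathcal{Q}}$ that are regular in $\mathfrak{g}$ (centralizer of dimension $n+1$). *)

(* Defs.v *)
From HB Require Import structures.
From mathcomp Require Import all_boot all_order all_algebra.
From mathcomp Require Import reals.
From mathcomp.real_closed Require Import complex.
Import GRing.Theory.
Local Open Scope ring_scope.

Section GKdefs.
Variable F : fieldType.
Variable N : nat.   (* N = n + 1 :  g = gl(N, F) = 'M[F]_N *)

(* Upper-left corners.  The index  i : 'I_N  stands for the size i+1, *)
(* so  trunc i x  is  x_{i+1} = pi_{i+1}(x)  viewed in gl(i+1).        *)
Definition trunc {T : Type} (i : 'I_N) (x : 'M[T]_N) : 'M[T]_(i.+1) :=
  \matrix_(a < i.+1, b < i.+1) x (widen_ord (ltn_ord i) a) (widen_ord (ltn_ord i) b).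

Definition fij (i j : 'I_N) (x : 'M[F]_N) : F := \tr ((trunc i x) ^+ j.+1).

Definition Phi_zero (x : 'M[F]_N) : Prop :=
  forall i j : 'I_N, (j <= i)%N -> fij i j x = 0.

(* Differential of the polynomial function f_{i+1,j+1} at x, applied to
   a tangent vector y:  the coefficient of t in  f_{i+1,j+1}(x + t y). *)
Definition dfij (i j : 'I_N) (x y : 'M[F]_N) : F :=
  (\tr ((trunc i (\matrix_(a, b) ((x a b)%:P + (y a b)%:P * 'X)
            : 'M[{poly F}]_N)) ^+ j.+1))`_1.

Definition strongly_regular (x : 'M[F]_N) : Prop :=
  forall c : 'I_N -> 'I_N -> F,
    (forall y : 'M[F]_N,
        \sum_(i < N) \sum_(j < N | (j <= i)%N) c i j * dfij i j x y = 0) ->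
    forall i j : 'I_N, (j <= i)%N -> c i j = 0.

Definition Phi_zero_sreg (x : 'M[F]_N) : Prop :=
  Phi_zero x /\ strongly_regular x.

Definition regular (x : 'M[F]_N) : Prop := \rank ('C(mxvec x))%MS = N.

(* K_m = GL(m-1) x GL(1): invertible block diagonal matrices of size m. *)
Definition in_K {m : nat} (g : 'M[F]_m.+1) : Prop :=
  g \in unitmx /\
  forall a b : 'I_m.+1, (a == ord_max) != (b == ord_max) -> g a b = 0.

Definition triang {m : nat} (sgn : bool) (z : 'M[F]_m) : Prop :=
  forall a b : 'I_m, (if sgn then (b < a)%N else (a < b)%N) -> z a b = 0.

(* B (a subset of gl(m+1)) is a Borel subalgebra lying in Q_{+,m+1}
   (sgn = true) or Q_{-,m+1} (sgn = false), i.e. B = Ad(k) b_{+/-} with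
   k in K_{m+1}. *)
Definition in_Q {m : nat} (sgn : bool) (B : 'M[F]_m.+1 -> Prop) : Prop :=
  exists k : 'M[F]_m.+1, in_K k /\
    forall y, B y <-> exists z, triang sgn z /\ y = k *m z *m invmx k.

Definition proj_set (i : 'I_N) (b : 'M[F]_N -> Prop) : 'M[F]_(i.+1) -> Prop :=
  fun y => exists x, b x /\ y = trunc i x.

(* A sequence Q = (Q_1, ..., Q_N) with Q_i in {Q_{+,i}, Q_{-,i}} is coded
   by s : 'I_N.-1 -> bool:  Q_1 = Q_{+,1} (= Q_{-,1}), and for i >= 1,
   Q_{i+1} = Q_{+,i+1} if s (i-1) and Q_{-,i+1} otherwise. *)
Definition Qsign (s : 'I_N.-1 -> bool) (i : 'I_N) : bool :=
  if nat_of_ord i is k.+1 then odflt true (omap s (insub k)) else true.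

Definition is_bQ (s : 'I_N.-1 -> bool) (b : 'M[F]_N -> Prop) : Prop :=
  forall i : 'I_N, in_Q (Qsign s i) (proj_set i b).

(* derived algebra [b, b]: linear span of commutators (for a subspace b,
   the set of finite sums of commutators of elements of b) *)
Definition derived (b : 'M[F]_N -> Prop) : 'M[F]_N -> Prop :=
  fun x => exists (m : nat) (ys zs : 'I_m -> 'M[F]_N),
    (forall k, b (ys k) /\ b (zs k)) /\
    x = \sum_(k < m) (ys k *m zs k - zs k *m ys k).

Definition nreg (b : 'M[F]_N -> Prop) : 'M[F]_N -> Prop :=
  fun x => derived b x /\ regular x.

Inductive polyfun : ('M[F]_N -> F) -> Prop :=
  | polyfun_const (c : F) : polyfun (fun _ => c)
  | polyfun_coord (a b : 'I_N) : polyfun (fun x => x a b)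
  | polyfun_add f g : polyfun f -> polyfun g -> polyfun (fun x => f x + g x)
  | polyfun_mul f g : polyfun f -> polyfun g -> polyfun (fun x => f x * g x).

Definition zariski_closed (Z : 'M[F]_N -> Prop) : Prop :=
  exists S : ('M[F]_N -> F) -> Prop,
    (forall f, S f -> polyfun f) /\
    forall x, Z x <-> (forall f, S f -> f x = 0).

Definition irreducible (Y : 'M[F]_N -> Prop) : Prop :=
  (exists y, Y y) /\
  forall Z1 Z2, zariski_closed Z1 -> zariski_closed Z2 ->
    (forall y, Y y -> Z1 y \/ Z2 y) ->
    (forall y, Y y -> Z1 y) \/ (forall y, Y y -> Z2 y).

Definition irreducible_component (X Y : 'M[F]_N -> Prop) : Prop :=
  (forall y, Y y -> X y) /\ irreducible Y /\
  forall Y', (forall y, Y y -> Y' y) -> (forall y, Y' y -> X y) ->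
    irreducible Y' -> forall y, Y' y -> Y y.

End GKdefs.

Arguments trunc {N T} i x.
Arguments fij {F N} i j x.
Arguments Phi_zero {F N} x.
Arguments dfij {F N} i j x y.
Arguments strongly_regular {F N} x.
Arguments Phi_zero_sreg {F N} x.
Arguments regular {F N} x.
Arguments in_K {F m} g.
Arguments triang {F m} sgn z.
Arguments in_Q {F m} sgn B.
Arguments proj_set {F N} i b _.
Arguments Qsign {N} s i.
Arguments is_bQ {F N} s b.
Arguments derived {F N} b _.
Arguments nreg {F N} b _.
Arguments polyfun {F N} _.
Arguments zariski_closed {F N} Z.
Arguments irreducible {F N} Y.
Arguments irreducible_component {F N} X Y.

(* Main.v *)
(** Write a leading corner of x as [[A, b], [c, 0]] with A the previous corner.
    If all corners are nilpotent then c A^k b = 0 for every k.  If b and c were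
    both nonzero, neither would be cyclic for the regular nilpotent A, so the
    m-th power of the corner, which is the sum of the A^i b c A^(m-2-i) where m
    is the size of A, would commute with A and hence be a polynomial in A,
    against strong regularity.  So b = 0 or c = 0 at every step: x is
    strictly triangular for the total order on the indices in which each index
    is put above or below all smaller ones, according to the signs of the
    sequence.  The Borel subalgebra of the sequence consists of the matrices
    triangular for that order, and a strictly triangular x of size n + 1 is
    regular, resp. strongly regular, if and only if x^n <> 0.  This is an open
    condition on a linear space, hence defines an irreducible set, and the
    finitely many linear spaces have disjoint regular parts. *)
Require Import Defs.
From HB Require Import structures.
From mathcomp Require Import all_boot all_order all_algebra.
From mathcomp Require Import zify.
From mathcomp Require Import reals.
From mathcomp.real_closed Require Import complex.
From Stdlib Require Import Classical FunctionalExtensionality.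
Import GRing.Theory Num.Theory.
Set Implicit Arguments.
Unset Strict Implicit.
Unset Printing Implicit Defensive.
Local Open Scope ring_scope.

(** * Powers of a bordered element, in an abstract ring *)

Section BorderedPowers.
Variables (R : pzRingType) (A b c : R).
Hypotheses (bA : b * A = 0) (bb : b * b = 0) (Ac : A * c = 0) (cc : c * c = 0).

(** Expand into words in [A], [b], [c]. By the hypotheses [b] can only be last or followed by [c],
    and [c] can only be first or preceded by [b]. A word where [b] occurs somewhere after a [c]
    contains some [c * A ^+ i * b] with [i < j], so it vanishes too. *)
Lemma bordered_exprS (j : nat) :
    (forall i : nat, (i < j)%N -> c * A ^+ i * b = 0) ->
  (A + b + c) ^+ j.+1 =
  A ^+ j.+1 + \sum_(i < j) A ^+ i * b * c * A ^+ (j.-1 - i) +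
  A ^+ j * b + c * A ^+ j.
Proof.
elim: j => [|j IHj] cAb; first by rewrite big_ord0 !expr1 expr0 addr0 mul1r mulr1.
rewrite exprSr IHj; last by move=> i lt_ij; rewrite cAb // ltnW.
have Sb : (\sum_(i < j) A ^+ i * b * c * A ^+ (j.-1 - i)) * b = 0.
  rewrite mulr_suml big1 // => i _; rewrite -!mulrA (mulrA c) cAb ?mulr0 //.
  by case: i => i /= /[dup] ? ?; lia.
have Sc : (\sum_(i < j) A ^+ i * b * c * A ^+ (j.-1 - i)) * c = 0.
  rewrite mulr_suml big1 // => i _; rewrite -!mulrA.
  by case: (_ - _)%N => [|k]; rewrite ?expr0 ?mul1r ?cc ?exprSr -?mulrA ?Ac !mulr0.
have SA : (\sum_(i < j) A ^+ i * b * c * A ^+ (j.-1 - i)) * A =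
    \sum_(i < j) A ^+ i * b * c * A ^+ (j - i).
  rewrite mulr_suml; apply: eq_bigr => i _; rewrite -mulrA -exprSr.
  by congr (_ * A ^+ _); case: i => i /= ?; lia.
have cAc k : c * A ^+ k * c = 0.
  by case: k => [|k]; rewrite ?expr0 ?mulr1 // exprSr -!mulrA Ac !mulr0.
rewrite !mulrDr !mulrDl Sb Sc SA cAc cAb // -[_ * b * b]mulrA bb.
rewrite -[_ * b * A]mulrA bA !mulr0.
have Ajc : A ^+ j.+1 * c = 0 by rewrite exprSr -mulrA Ac mulr0.
rewrite Ajc -exprSr -[c * _ * A]mulrA -exprSr !(add0r, addr0).
rewrite big_ord_recr /= subnn expr0 mulr1 -!addrA; congr (_ + (_ + _)).
by rewrite addrCA addrA addrC.
Qed.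

End BorderedPowers.

(** * Cyclic vectors and the centralizer of a regular nilpotent matrix *)

Section NilpotentPowers.
Variables (F : fieldType) (n : nat) (A : 'M[F]_n.+1).

Lemma trmxX (M : 'M[F]_n.+1) (k : nat) : (M ^+ k)^T = M^T ^+ k.
Proof.
elim: k => [|k IHk]; first by rewrite !expr0 [LHS]trmx1.
by rewrite exprSr -mulmxE trmx_mul IHk exprS.
Qed.

Lemma mulmx_exp0 (q m k : nat) (B : 'M[F]_(q, n.+1)) :
  B *m A ^+ m = 0 -> (m <= k)%N -> B *m A ^+ k = 0.
Proof.
by move=> BAm /subnKC <-; rewrite exprD -mulmxE mulmxA BAm mul0mx.
Qed.

(** Strong induction on [k]: after multiplication by [A ^+ (m - k)] the terms above [k] die by
    nilpotency and those below by induction, leaving [d k *: (B *m A ^+ m)]. *)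
Lemma nilpotent_powers_free (q m : nat) (B : 'M[F]_(q, n.+1)) (d : nat -> F) :
    B *m A ^+ m.+1 = 0 -> B *m A ^+ m != 0 ->
    \sum_(k < m.+1) d k *: (B *m A ^+ k) = 0 ->
  forall k : nat, (k <= m)%N -> d k = 0.
Proof.
move=> BAm1 BAm d0; elim/ltn_ind => k IHk le_km.
have: (\sum_(i < m.+1) d i *: (B *m A ^+ i)) *m A ^+ (m - k) = 0.
  by rewrite d0 mul0mx.
rewrite mulmx_suml (bigD1 (inord k)) //= big1 => [|i neq_ik]; last first.
  have [lt_ik|le_ki] := ltnP i k; first by rewrite IHk ?scale0r ?mul0mx // (leq_trans (ltnW lt_ik)).
  rewrite -scalemxAl -mulmxA mulmxE -exprD (@mulmx_exp0 _ m.+1) ?scaler0 //.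
  have: nat_of_ord i != k.
    by apply: contraNneq neq_ik => eq_ik; apply/eqP/val_inj; rewrite /= inordK.
  lia.
rewrite inordK // addr0 -scalemxAl -mulmxA mulmxE -exprD subnKC //.
by move/eqP; rewrite scaler_eq0 (negPf BAm) orbF => /eqP.
Qed.

Variables (m : nat) (P : 'M[F]_n.+1).
Hypotheses (rankP : \rank P = m.+1) (AP : A *m P = A) (PP : P *m P = P).

(** The row space of the idempotent [P] has dimension [m.+1] and is stable under [A]; it contains
    the [m.+1] free iterates of [u], which therefore fill it. *)
Lemma cyclic_spans (u : 'rV[F]_n.+1) :
    u *m P = u -> u *m A ^+ m.+1 = 0 -> u *m A ^+ m != 0 ->
  (P <= \matrix_(k < m.+1) (u *m A ^+ k))%MS.
Proof.
move=> uP uAm1 uAm; set V := (X in (_ <= X)%MS).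
have mulV (w : 'rV_m.+1) : w *m V = \sum_(k < m.+1) w 0 k *: (u *m A ^+ k).
  by rewrite mulmx_sum_row; apply: eq_bigr => k _; rewrite rowK.
have freeV : row_free V.
  apply: inj_row_free => w; rewrite mulV => w0; apply/rowP => k; rewrite mxE.
  have := @nilpotent_powers_free _ m u (fun k => w 0 (inord k)) uAm1 uAm.
  move=> /(_ _ k (ltn_ord k)); rewrite inord_val; apply.
  by rewrite -[RHS]w0; apply: eq_bigr => i _; rewrite inord_val.
have sVP : (V <= P)%MS.
  apply/row_subP => k; rewrite rowK; case: (nat_of_ord k) => [|j].
    by rewrite expr0 mulmx1 -uP submxMl.
  by rewrite exprSr -mulmxE -AP !mulmxA submxMl.
by rewrite -(geq_leqif (mxrank_leqif_sup sVP)) rankP -[X in (X <= _)%N](eqP freeV).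
Qed.

(** This turns the vanishing of all [c * A ^+ k * b] into the vanishing of one border as soon as the
    other is cyclic. *)
Lemma cyclic_annihilator (q : nat) (u : 'rV[F]_n.+1) (B : 'M[F]_(n.+1, q)) :
    u *m P = u -> u *m A ^+ m.+1 = 0 -> u *m A ^+ m != 0 ->
    (forall k : nat, (k <= m)%N -> u *m A ^+ k *m B = 0) ->
  P *m B = 0.
Proof.
move=> uP uAm1 uAm uAB.
have /submxP[Y ->] := cyclic_spans uP uAm1 uAm.
rewrite -mulmxA; suff -> : (\matrix_(k < m.+1) (u *m A ^+ k)) *m B = 0 by rewrite mulmx0.
by apply/row_matrixP => k; rewrite row_mul rowK row0 uAB // -ltnS.
Qed.

Hypothesis PA : P *m A = A.

(** A matrix commuting with [A] in the corner cut out by [P] is determined by its value on a cyclic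
    vector. The term of degree zero is [P], the unit of that corner. *)
Lemma nilpotent_centralizer (S : 'M[F]_n.+1) :
    A ^+ m.+1 = 0 -> P *m A ^+ m != 0 ->
    P *m S = S -> S *m P = S -> A *m S = S *m A ->
  exists d : nat -> F, S = \sum_(k < m.+1) d k *: (P *m A ^+ k).
Proof.
move=> Am1 PAm PS SP AS.
have [i PAmi] : exists i, row i (P *m A ^+ m) != 0.
  apply/existsP; apply: contraNT PAm => /existsPn r0; apply/eqP/row_matrixP => i.
  by rewrite row0; apply/eqP; have := r0 i; rewrite negbK.
pose u := row i P.
have uP : u *m P = u by rewrite -row_mul PP.
have uAm1 : u *m A ^+ m.+1 = 0 by rewrite Am1 mulmx0.
have uAm : u *m A ^+ m != 0 by rewrite -row_mul.
have /submxP[w defuS] : (u *m S <= \matrix_(k < m.+1) (u *m A ^+ k))%MS.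
  by rewrite -SP mulmxA (submx_trans (submxMl _ _)) // cyclic_spans.
(* [T] is the polynomial in [A] that agrees with [S] on the cyclic vector [u]. *)
exists (fun k => w 0 (inord k)); set T := RHS.
have commX (M : 'M[F]_n.+1) k : A *m M = M *m A -> A ^+ k *m M = M *m A ^+ k.
  move=> AM; elim: k => [|k IHk]; first by rewrite mul1mx mulmx1.
  by rewrite exprSr -mulmxE -mulmxA AM mulmxA IHk mulmxA.
have PT : P *m T = T.
  rewrite mulmx_sumr; apply: eq_bigr => k _.
  by rewrite -scalemxAr mulmxA PP.
have AT : A *m T = T *m A.
  rewrite mulmx_sumr mulmx_suml; apply: eq_bigr => k _.
  rewrite -scalemxAr -scalemxAl mulmxA AP -{1}PA -!mulmxA mulmxE -exprS exprSr.
  by rewrite !mulrA.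
suff: P *m (S - T) = 0 by rewrite mulmxBr PS PT => /eqP; rewrite subr_eq0 => /eqP.
apply: (cyclic_annihilator uP uAm1 uAm) => k _.
have uS : u *m S = u *m T.
  rewrite defuS mulmx_sum_row mulmx_sumr; apply: eq_bigr => j _.
  by rewrite rowK inord_val -scalemxAr mulmxA uP.
by rewrite -mulmxA mulmxBr !commX // -mulmxBl mulmxA mulmxBr uS subrr mul0mx.
Qed.

End NilpotentPowers.

(** * A nilpotent corner with one more row and column *)

Section Bordered.
Variables (F : numFieldType) (n m : nat) (P A b c : 'M[F]_n.+1).
Hypotheses (PP : P * P = P) (PA : P * A = A) (AP : A * P = A).
Hypotheses (Pb : P * b = b) (bP : b * P = 0) (Pc : P * c = 0) (cP : c * P = c).

Let bA : b * A = 0. Proof. by rewrite -PA mulrA bP mul0r. Qed.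
Let bb : b * b = 0. Proof. by rewrite -{2}Pb mulrA bP mul0r. Qed.
Let Ac : A * c = 0. Proof. by rewrite -AP -mulrA Pc mulr0. Qed.
Let cc : c * c = 0. Proof. by rewrite -{1}cP -mulrA Pc mulr0. Qed.

(** By cyclicity of the trace, the words that contribute besides [A ^+ k.+2] are the [k.+2]
    rotations of [c * A ^+ k * b]. *)
Lemma bordered_mxtrace (k : nat) :
    (forall i : nat, (i < k)%N -> c * A ^+ i * b = 0) ->
  \tr ((A + b + c) ^+ k.+2) = \tr (A ^+ k.+2) + \tr (c * A ^+ k * b) *+ k.+2.
Proof.
move=> cAb.
have trC (M N : 'M[F]_n.+1) : \tr (M * N) = \tr (N * M) by exact: mxtrace_mulC.
rewrite exprSr (bordered_exprS bA bb Ac cc cAb) !mulrDr !mulrDl -exprSr !mxtraceD.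
have AjC j : c * A ^+ j * A = c * A ^+ j.+1 by rewrite -mulrA -exprSr.
have trAb : \tr (A ^+ k.+1 * b) = 0 by rewrite trC exprS mulrA bA mul0r mxtrace0.
have AAc j : A ^+ j.+1 * c = 0 by rewrite exprSr -mulrA Ac mulr0.
have trcA : \tr (c * A ^+ k.+1) = 0 by rewrite trC AAc mxtrace0.
have trcc : \tr (c * A ^+ k * c) = 0 by rewrite trC mulrA cc mul0r mxtrace0.
have trbc : \tr (A ^+ k * b * c) = \tr (c * A ^+ k * b) by rewrite trC mulrA.
rewrite AjC trAb AAc trcA trcc trbc -[_ * b * A]mulrA -[_ * b * b]mulrA bA bb.
rewrite !mulr0 mxtrace0 !mulr_suml.
rewrite [\sum_(i < k) _ * b](_ : _ = 0) ?mxtrace0; last first.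
  rewrite big1 // => i _; rewrite -!mulrA (mulrA c) cAb ?mulr0 //.
  by case: i => i /= ?; lia.
rewrite [\sum_(i < k) _ * c](_ : _ = 0) ?mxtrace0; last first.
  rewrite big1 // => i _; rewrite -!mulrA.
  by case: (_ - _)%N => [|j]; rewrite ?expr0 ?mul1r ?cc ?AAc ?mulr0.
rewrite raddf_sum /= (eq_bigr (fun=> \tr (c * A ^+ k * b))) => [|i _]; last first.
  rewrite -[_ * A]mulrA -exprSr -!mulrA [LHS]trC -!mulrA -exprD [LHS]trC !mulrA.
  by congr (\tr (_ * A ^+ _ * _)); case: i => i /= ?; lia.
rewrite sumr_const card_ord !(addr0, add0r) -!addrA -(addn2 k) mulrnDr addn2.
by rewrite mulr2n.
Qed.

Hypotheses (rankP : \rank P = m.+1) (Am1 : A ^+ m.+1 = 0).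
Hypothesis cAb : forall k : nat, c * A ^+ k * b = 0.

(** Some column of [b] is cyclic for [A], and [c] kills all its iterates. Transposition reduces this
    to the statement on row vectors. *)
Lemma bordered_cyclic_col : A ^+ m * b != 0 -> c = 0.
Proof.
move=> Amb.
have [j Amj] : exists j, row j (A ^+ m * b)^T != 0.
  apply/existsP; apply: contraNT Amb => /existsPn r0.
  rewrite -[_ * b]trmxK; apply/eqP; rewrite -[RHS]trmx0; congr _^T.
  by apply/row_matrixP => j; rewrite row0; apply/eqP; have := r0 j; rewrite negbK.
apply: trmx_inj; rewrite trmx0 -cP -mulmxE trmx_mul.
have trE k : row j b^T *m A^T ^+ k = row j (A ^+ k * b)^T.
  by rewrite -mulmxE trmx_mul row_mul trmxX.
apply: (@cyclic_annihilator _ _ A^T m P^T _ _ _ (row j b^T)).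
- by rewrite mxrank_tr.
- by rewrite -trmx_mul [P *m A]PA.
- by rewrite -row_mul -trmx_mul [P *m b]Pb.
- by rewrite trE Am1 mul0r trmx0 row0.
- by rewrite trE.
move=> k _; rewrite trE -row_mul -trmx_mul mulmxE mulrA cAb.
by rewrite trmx0 row0.
Qed.

Lemma bordered_cyclic_row : c * A ^+ m != 0 -> b = 0.
Proof.
move=> cAm; have [j cAj] : exists j, row j (c * A ^+ m) != 0.
  apply/existsP; apply: contraNT cAm => /existsPn r0.
  by apply/eqP/row_matrixP => j; rewrite row0; apply/eqP; have := r0 j; rewrite negbK.
rewrite -Pb; apply: (@cyclic_annihilator _ _ A m P _ _ _ (row j c)) => //.
- by rewrite -row_mul [c *m P]cP.
- by rewrite Am1 mulmx0.
- by rewrite -row_mul.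
by move=> k _; rewrite -!row_mul [c *m _ *m _]cAb row0.
Qed.

(* If neither border vanishes, neither is cyclic for A; then the power is the sum
   S of the A^i b c A^(m-1-i), and the commutator of S with A telescopes to 0. *)
Lemma bordered_dependent :
    P * A ^+ m != 0 -> b != 0 -> c != 0 ->
  exists d : nat -> F, (A + b + c) ^+ m.+1 = \sum_(k < m.+1) d k *: (P * A ^+ k).
Proof.
move=> PAm b_neq0 c_neq0.
have Amb : A ^+ m * b = 0.
  by apply: contraNeq c_neq0 => /bordered_cyclic_col ->.
have cAm : c * A ^+ m = 0.
  by apply: contraNeq b_neq0 => /bordered_cyclic_row ->.
rewrite (bordered_exprS bA bb Ac cc) // Am1 Amb cAm add0r !addr0.
set S := \sum_(i < m) _.
apply: (@nilpotent_centralizer _ _ A m P) => //.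
- rewrite mulmx_sumr; apply: eq_bigr => -[[|i] ?] _; rewrite !mulmxE !mulrA.
    by rewrite expr0 mulr1 mul1r Pb.
  by rewrite exprS !mulrA PA.
- rewrite mulmx_suml; apply: eq_bigr => -[i ?] _; rewrite !mulmxE -!mulrA /=.
  by case: (_ - _)%N => [|k]; rewrite ?expr0 ?mul1r ?mulr1 ?cP // exprSr -!mulrA AP.
pose g i := A ^+ i * b * c * A ^+ (m - i).
have -> : A *m S = \sum_(i < m) g i.+1.
  rewrite mulmx_sumr; apply: eq_bigr => i _; rewrite /g mulmxE !mulrA -exprS.
  by congr (_ * A ^+ _); case: i => i /= ?; lia.
have -> : S *m A = \sum_(i < m) g i.
  rewrite mulmx_suml; apply: eq_bigr => i _; rewrite /g mulmxE -[LHS]mulrA -exprSr.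
  by congr (_ * A ^+ _); case: i => i /= ?; lia.
have: \sum_(i < m.+1) g i = \sum_(i < m.+1) g i by [].
rewrite {1}big_ord_recl big_ord_recr /= /g subnn Amb !mul0r addr0.
by rewrite subn0 expr0 mul1r -mulrA cAm mulr0 add0r.
Qed.

End Bordered.

(** * Leading corners padded with zeros, and the differentials of the trace functions *)

Section Corners.
Variables (F : numFieldType) (n : nat).
Implicit Types x y : 'M[F]_n.+1.

(** Padding keeps the corners of all sizes in one matrix ring, where they can be added and
    multiplied without casts. *)
Definition cproj (m : nat) : 'M[F]_n.+1 := pid_mx m.
Definition corner (m : nat) x := cproj m * x * cproj m.

Lemma cproj_id (m : nat) : cproj m * cproj m = cproj m.
Proof.
have [le_m|lt_m] := leqP m n.+1; first exact: pid_mx_id.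
by rewrite /cproj -!(pid_mx_minh _ _ _ m) (minn_idPl (ltnW lt_m)) [LHS]pid_mx_id.
Qed.

Lemma cproj_full : cproj n.+1 = 1.
Proof. exact: pid_mx_1. Qed.

Lemma corner_full x : corner n.+1 x = x.
Proof. by rewrite /corner cproj_full mul1r mulr1. Qed.

Lemma cprojM (m : nat) x (a b : 'I_n.+1) :
  (cproj m * x) a b = x a b *+ (a < m)%N.
Proof.
rewrite -mulmxE mxE (bigD1 a) //= big1 ?addr0 => [|j neq_ja].
  by rewrite mxE eqxx /= mulr_natl.
by rewrite mxE eq_sym val_eqE (negPf neq_ja) mul0r.
Qed.

Lemma Mcproj (m : nat) x (a b : 'I_n.+1) :
  (x * cproj m) a b = x a b *+ (b < m)%N.
Proof.
rewrite -mulmxE mxE (bigD1 b) //= big1 ?addr0 => [|j neq_jb].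
  by rewrite mxE eqxx /= mulr_natr.
by rewrite mxE val_eqE (negPf neq_jb) mulr0.
Qed.

Lemma cproj_corner (m : nat) x : cproj m * corner m x = corner m x.
Proof. by rewrite /corner !mulrA cproj_id. Qed.

Lemma corner_cproj (m : nat) x : corner m x * cproj m = corner m x.
Proof. by rewrite /corner -!mulrA cproj_id. Qed.

(* The power of the m x m corner, padded with zeros: [cpow m 0 x] is [cproj m],
   not 1. *)
Definition cpow (m k : nat) x := cproj m * corner m x ^+ k.

Lemma cpow_cproj (m k : nat) x : cpow m k x * cproj m = cpow m k x.
Proof.
rewrite /cpow; case: k => [|k]; first by rewrite expr0 mulr1 cproj_id.
by rewrite exprSr mulrA -[LHS]mulrA corner_cproj.
Qed.

Lemma cproj_cpow (m k : nat) x : cproj m * cpow m k x = cpow m k x.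
Proof. by rewrite /cpow mulrA cproj_id. Qed.

Lemma cpowS (m k : nat) x : cpow m k.+1 x = corner m x ^+ k.+1.
Proof. by rewrite /cpow exprS mulrA cproj_corner. Qed.

(** The two rectangular [pid_mx] multiply to 1 in one order and to [cproj i.+1] in the other, so
    compression to size [i.+1] is multiplicative on padded corners. *)
Lemma trunc_exp (i : 'I_n.+1) x (k : nat) :
  trunc i x ^+ k = pid_mx i.+1 *m corner i.+1 x ^+ k *m pid_mx i.+1.
Proof.
have LP : (pid_mx i.+1 : 'M_(i.+1, n.+1)) *m cproj i.+1 = pid_mx i.+1.
  by rewrite [LHS]pid_mx_id.
have truncE : trunc i x = pid_mx i.+1 *m x *m pid_mx i.+1.
  apply/matrixP => a b; rewrite !mxE (bigD1 (widen_ord (ltn_ord i) b)) //= big1.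
    rewrite mxE (bigD1 (widen_ord (ltn_ord i) a)) //= big1.
      by rewrite !mxE /= !eqxx /= (valP a) (valP b) mul1r mulr1 !addr0.
    move=> j; rewrite -val_eqE /= => neq_ja.
    by rewrite mxE /= eq_sym (negPf neq_ja) mul0r.
  by move=> j; rewrite -val_eqE /= => neq_jb; rewrite !mxE /= (negPf neq_jb) mulr0.
elim: k => [|k IHk]; first by rewrite !expr0 mulmx1 pid_mx_id // pid_mx_1.
rewrite exprS IHk truncE -mulmxE !mulmxA -[_ *m pid_mx _ *m pid_mx _]mulmxA.
rewrite [X in _ *m X *m _ *m _]pid_mx_id // -/(cproj i.+1).
by rewrite exprS /corner -!mulmxE !mulmxA LP.
Qed.

Lemma fij_corner (i j : 'I_n.+1) x : fij i j x = \tr (corner i.+1 x ^+ j.+1).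
Proof.
rewrite /fij trunc_exp mxtrace_mulC mulmxA pid_mx_id // -/(cproj i.+1).
by rewrite exprS -!mulmxE mulmxA [cproj _ *m _]cproj_corner.
Qed.

(** Modulo ['X^2] the matrix [M] is [A + Y 'X]. The linear coefficient of its power is the sum of
    the [A ^+ i * Y * A ^+ (j - i)], whose [j.+1] terms have the same trace. *)
Lemma coef1_expmx (k j : nat) (M : 'M[{poly F}]_k.+1) (A Y : 'M[F]_k.+1) :
    (forall a b, (M a b)`_0 = A a b) -> (forall a b, (M a b)`_1 = Y a b) ->
  (\tr (M ^+ j.+1))`_1 = j.+1%:R * \tr (A ^+ j * Y).
Proof.
move=> M0 M1.
have X0 l a b : ((M ^+ l) a b)`_0 = (A ^+ l) a b.
  elim: l a b => [|l IHl] a b; first by rewrite !expr0 !mxE; case: eqP => _; rewrite ?coef1 ?coef0.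
  rewrite !exprSr -!mulmxE !mxE coef_sum; apply: eq_bigr => c _.
  by rewrite coefM big_ord_recl big_ord0 addr0 IHl M0.
have X1 l a b : ((M ^+ l) a b)`_1 = (\sum_(i < l) A ^+ i * Y * A ^+ (l.-1 - i)) a b.
  elim: l a b => [|l IHl] a b.
    by rewrite !expr0 big_ord0 !mxE; case: eqP => _; rewrite ?coef1 ?coef0.
  rewrite big_ord_recr /= subnn expr0 mulr1 exprSr -!mulmxE !mxE coef_sum.
  rewrite (eq_bigr (fun i : 'I_l => A ^+ i * Y * A ^+ (l.-1 - i) * A)); last first.
    by move=> i _; rewrite -[RHS]mulrA -exprSr; congr (_ * A ^+ _); case: i => i /= ?; lia.
  rewrite -mulr_suml -mulmxE mxE -big_split; apply: eq_bigr => c _ /=.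
  by rewrite coefM !big_ord_recl big_ord0 addr0 /= subn0 /bump /= subnn X0 IHl M0 M1 addrC.
rewrite coef_sum (eq_bigr (fun a => (\sum_(i < j.+1) A ^+ i * Y * A ^+ (j - i)) a a)) => [|a _]; last exact: X1.
rewrite -/(\tr _) raddf_sum /= (eq_bigr (fun=> \tr (A ^+ j * Y))) => [|i _]; last first.
  by rewrite -mulmxE mxtrace_mulC mulmxA mulmxE -exprD subnK // -ltnS.
by rewrite sumr_const card_ord mulr_natl.
Qed.

Lemma dfij_cpow (i j : 'I_n.+1) x y :
  dfij i j x y = j.+1%:R * \tr (cpow i.+1 j x * y).
Proof.
rewrite /dfij (@coef1_expmx _ _ _ (trunc i x) (trunc i y)); first last.
- by move=> a b; rewrite !mxE coefD coefC coefMX coefC /= add0r.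
- by move=> a b; rewrite !mxE coefD coefC coefMX /= addr0.
congr (_ * _); rewrite -[trunc i y]expr1 !trunc_exp expr1.
rewrite -mulmxE !mulmxA -[_ *m pid_mx _ *m pid_mx _]mulmxA pid_mx_id // -/(cproj i.+1).
rewrite mxtrace_mulC !mulmxA pid_mx_id // -/(cproj i.+1) !mulmxE -/(cpow _ _ _).
rewrite ?cpow_cproj -mulmxE mxtrace_mulC.
by rewrite !mulmxE mulrA cproj_cpow.
Qed.

End Corners.

(** * The row and the column that extend a corner to the next one *)

Section Borders.
Variables (F : numFieldType) (n : nat).
Implicit Types (x : 'M[F]_n.+1) (m : 'I_n.+1).

Notation P := (cproj F n).

Definition unit_proj m : 'M[F]_n.+1 := delta_mx m m.
(** The blocks [b] and [c] of the corner of size [m.+1], again padded with zeros. *)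
Definition col_border m x := P m * x * unit_proj m.
Definition row_border m x := unit_proj m * x * P m.

Lemma unit_proj_id m : unit_proj m * unit_proj m = unit_proj m.
Proof. by rewrite -mulmxE mul_delta_mx. Qed.

Lemma cproj_unit m : P m * unit_proj m = 0.
Proof.
apply/matrixP => a b; rewrite cprojM !mxE.
by case: eqP => [->|_]; rewrite ?ltnn ?mulr0n // mul0rn.
Qed.

Lemma unit_cproj m : unit_proj m * P m = 0.
Proof.
apply/matrixP => a b; rewrite Mcproj !mxE andbC.
by case: eqP => [->|_]; rewrite ?ltnn ?mulr0n // mul0rn.
Qed.

Lemma cprojS m : P m.+1 = P m + unit_proj m.
Proof.
apply/matrixP => a b; rewrite !mxE ltnS leq_eqVlt -!val_eqE /=.
have [<-|neq_ab] := eqVneq (a : nat) b; last first.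
  by have [eq_am|_] := eqVneq (a : nat) m; rewrite ?addr0 // -eq_am eq_sym (negPf neq_ab) addr0.
by have [->|_] := eqVneq (a : nat) m; rewrite /= ?ltnn ?add0r ?addr0.
Qed.

Lemma unit_sandwich m (M : 'M[F]_n.+1) : unit_proj m * M * unit_proj m = M m m *: unit_proj m.
Proof.
apply/matrixP => a b; rewrite -!mulmxE [RHS]mxE mxE (bigD1 m) //= big1 ?addr0.
  rewrite mxE (bigD1 m) //= big1 ?addr0 => [|j neq_jm].
    rewrite !mxE !eqxx /= andbT; case: eqP => _; last by rewrite !mul0r mulr0.
    by rewrite mul1r.
  by rewrite !mxE (negPf neq_jm) andbF mul0r.
by move=> j neq_jm; rewrite [unit_proj m j b]mxE (negPf neq_jm) mulr0.
Qed.

Lemma cornerS m x :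
  corner m.+1 x =
  corner m x + col_border m x + row_border m x + x m m *: unit_proj m.
Proof.
rewrite /corner cprojS !mulrDl !mulrDr unit_sandwich -!addrA.
by congr (_ + _).
Qed.

Section OneBorder.
Variables (m : 'I_n.+1) (x : 'M[F]_n.+1).
Let A := corner m x.
Let b := col_border m x.
Let c := row_border m x.

Lemma cproj_col : P m * b = b. Proof. by rewrite /b /col_border !mulrA cproj_id. Qed.
Lemma col_cproj : b * P m = 0.
Proof. by rewrite /b /col_border -mulrA unit_cproj mulr0. Qed.
Lemma cproj_row : P m * c = 0.
Proof. by rewrite /c /row_border !mulrA cproj_unit !mul0r. Qed.
Lemma row_cproj : c * P m = c. Proof. by rewrite /c /row_border -!mulrA cproj_id. Qed.

Lemma col_unit : b * unit_proj m = b.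
Proof. by rewrite /b /col_border -!mulrA unit_proj_id. Qed.
Lemma unit_row : unit_proj m * c = c.
Proof. by rewrite /c /row_border !mulrA unit_proj_id. Qed.

Lemma col_corner : b * A = 0.
Proof. by rewrite -[A]cproj_corner mulrA col_cproj mul0r. Qed.
Lemma corner_row : A * c = 0.
Proof. by rewrite -[A]corner_cproj -mulrA cproj_row mulr0. Qed.

Lemma mxtrace_corner_col k : \tr (A ^+ k * b) = 0.
Proof.
rewrite -cproj_col mulrA -mulmxE mxtrace_mulC mulmxE; case: k => [|k].
  by rewrite expr0 mul1r col_cproj mxtrace0.
by rewrite exprS 2!mulrA col_corner !mul0r mxtrace0.
Qed.

Lemma mxtrace_row_corner k : \tr (c * A ^+ k) = 0.
Proof.
rewrite -row_cproj -mulrA -mulmxE mxtrace_mulC mulmxE; case: k => [|k].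
  by rewrite expr0 mulr1 cproj_row mxtrace0.
by rewrite exprSr -2!mulrA corner_row !mulr0 mxtrace0.
Qed.

(** The product is supported on the single entry [(m, m)], so its trace is that entry. *)
Lemma row_corner_col_eq0 k : \tr (c * A ^+ k * b) = 0 -> c * A ^+ k * b = 0.
Proof.
have -> : c * A ^+ k * b = unit_proj m * (c * A ^+ k * b) * unit_proj m.
  by rewrite 2!mulrA unit_row -[RHS]mulrA col_unit.
rewrite unit_sandwich mxtraceZ.
rewrite [\tr _](_ : _ = 1) ?mulr1 => [->|]; first by rewrite scale0r.
rewrite /mxtrace (bigD1 m) //= big1 ?addr0 => [|a neq_am]; first by rewrite mxE eqxx.
by rewrite mxE (negPf neq_am).
Qed.

(** With one border zero, every [c * A ^+ i * b] and every term of the sum in [bordered_exprS]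
    vanish. *)
Lemma half_border_exprS k : b = 0 \/ c = 0 ->
  (A + b + c) ^+ k.+1 = A ^+ k.+1 + A ^+ k * b + c * A ^+ k.
Proof.
move=> bc0; have bb : b * b = 0 by rewrite -{2}cproj_col mulrA col_cproj mul0r.
have cc : c * c = 0 by rewrite -{1}row_cproj -mulrA cproj_row mulr0.
rewrite (bordered_exprS col_corner bb corner_row cc); last first.
  by case: bc0 => -> *; rewrite ?mulr0 ?mul0r.
congr (_ + _ + _); rewrite big1 ?addr0 // => i _.
by case: bc0 => ->; rewrite ?mulr0 ?mul0r // mulr0 mul0r.
Qed.

End OneBorder.
End Borders.

(** * Strong regularity in the zero fibre as a condition on borders and on [x ^+ n] *)

Section StronglyRegular.
Variables (F : numFieldType) (n : nat).
Implicit Types (x : 'M[F]_n.+1) (m : 'I_n.+1).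

(** For the trace form, the gradients of the functions [fij] are these padded powers up to the
    factor [j.+1]. Coefficients indexed by [nat] avoid casts between ordinals. *)
Definition cpow_free x : Prop := forall c : nat -> nat -> F,
  \sum_(i < n.+1) \sum_(j < i.+1) c i j *: cpow i.+1 j x = 0 ->
  forall i j : nat, (j <= i)%N -> (i <= n)%N -> c i j = 0.

Lemma mxtrace_mul_eq0 (M : 'M[F]_n.+1) : (forall y, \tr (M * y) = 0) -> M = 0.
Proof.
move=> trM0; apply/matrixP => a b; rewrite [RHS]mxE -(trM0 (delta_mx b a)).
rewrite /mxtrace (bigD1 a) //= big1 => [|i neq_ia]; rewrite -mulmxE mxE.
  rewrite (bigD1 b) //= big1 => [|j neq_jb].
    by rewrite !mxE !eqxx mulr1 !addr0.
  by rewrite mxE (negPf neq_jb) mulr0.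
by rewrite big1 // => j _; rewrite mxE (negPf neq_ia) andbF mulr0.
Qed.

(** The trace form is nondegenerate, and the factors [j.+1] are invertible in characteristic
    zero. *)
Lemma strongly_regularP x : strongly_regular x <-> cpow_free x.
Proof.
have sum_narrow (V : nmodType) (f : 'I_n.+1 -> V) (i : 'I_n.+1) :
    \sum_(j < n.+1 | (j <= i)%N) f j = \sum_(j < i.+1) f (inord j).
  rewrite (big_ord_widen n.+1 (fun j => f (inord j))) ?ltn_ord //.
  by apply: eq_big => j; rewrite ?ltnS // inord_val.
have nz (j : nat) : j.+1%:R != 0 :> F by rewrite pnatr_eq0.
split=> [sreg c c0 i j le_ji le_in | cfree c c0 i j le_ji].
  have: c (inord i : 'I_n.+1) (inord j : 'I_n.+1) / j.+1%:R = 0.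
    rewrite -[in j.+1%:R](@inordK n j) ?ltnS ?(leq_trans le_ji) //.
    apply: (sreg (fun i j => c i j / j.+1%:R)); last by rewrite !inordK // ltnS (leq_trans le_ji).
    move=> y; rewrite -[RHS](mxtrace0 F n.+1) -(mul0mx _ y) -c0 mulmx_suml raddf_sum /=.
    apply: eq_bigr => k _; rewrite sum_narrow mulmx_suml raddf_sum /=.
    apply: eq_bigr => l _; rewrite dfij_cpow -scalemxAl mxtraceZ mulrA mulfVK //.
    by rewrite inordK // (leq_trans (ltn_ord l)) // ltnS.
  move/eqP; rewrite mulf_eq0 invr_eq0 (negPf (nz j)) orbF => /eqP.
  by rewrite !inordK // ltnS (leq_trans le_ji).
have := cfree (fun i j => c (inord i) (inord j) * j.+1%:R).
move=> /(_ _ i j le_ji (ltnSE (ltn_ord i))); rewrite !inord_val.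
move=> cij0; apply/eqP; move: cij0 => /(_ _)/eqP; rewrite mulf_eq0 (negPf (nz j)) orbF; apply.
apply: mxtrace_mul_eq0 => y; rewrite -[RHS](c0 y) mulr_suml raddf_sum /=.
apply: eq_bigr => k _; rewrite sum_narrow mulr_suml raddf_sum /= inord_val.
apply: eq_bigr => l _; rewrite dfij_cpow -!mulmxE -scalemxAl mxtraceZ mulrA inordK //.
by rewrite (leq_trans (ltn_ord l)) // ltnS.
Qed.

Lemma cpow_free_neq0 x (m k : nat) :
  cpow_free x -> (k < m)%N -> (m <= n.+1)%N -> cpow m k x != 0.
Proof.
case: m => // m cfree le_km le_mn; apply/eqP => xmk0.
suff /eqP: (1 : F) = 0 by rewrite oner_eq0.
have := cfree (fun i j => ((i == m) && (j == k))%:R).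
move=> /(_ _ m k le_km le_mn); rewrite !eqxx; apply.
rewrite big1 // => i _; rewrite big1 // => j _.
have [->|_] := eqVneq (j : nat) k; last by rewrite andbF scale0r.
by have [->|_] := eqVneq (i : nat) m; rewrite ?xmk0 ?scaler0 // scale0r.
Qed.

(** This is the independence that [bordered_dependent] contradicts. *)
Lemma cpow_free_indep x (m : nat) (d : nat -> F) :
    cpow_free x -> (0 < m)%N -> (m <= n)%N ->
  cpow m.+1 m x <> \sum_(k < m) d k *: cpow m k x.
Proof.
case: m => // m cfree _ lt_mn xm.
suff /eqP: (1 : F) = 0 by rewrite oner_eq0.
(* Index [i] stands for the corner of size [i.+1]: coefficient one on the top power of the larger
   corner, [- d] on the powers of the smaller one. *)
have := cfree (fun i j => ((i == m.+1) && (j == m.+1))%:R - d j *+ (i == m)).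
move=> /(_ _ m.+1 m.+1 (leqnn _) lt_mn); rewrite !eqxx gtn_eqF //= subr0; apply.
have m1m : (m.+1 == m) = false by rewrite gtn_eqF.
have mm1 : (m == m.+1) = false by rewrite ltn_eqF.
rewrite (bigD1 (inord m.+1)) //= addrC (bigD1 (inord m)) //=; last first.
  by rewrite -val_eqE /= !inordK //; lia.
rewrite !inordK //; last exact: ltnW.
rewrite [X in _ + X + _]big1 ?addr0; last first.
  move=> i /andP[im1 im]; move: im1 im; rewrite -!val_eqE /= !inordK //; last exact: ltnW.
  move=> im1 im; rewrite big1 // => j _.
  by rewrite (negPf im1) (negPf im) /= subr0 scale0r.
rewrite [X in _ + X]big_ord_recr /= [X in _ + (X + _)]big1 ?add0r => [|[j lt_jm] _].
  rewrite !eqxx m1m mm1 /= mulr0n subr0 scale1r xm -big_split big1 // => j _ /=.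
  by rewrite mulr1n sub0r scaleNr addNr.
by rewrite /= (ltn_eqF lt_jm) andbF m1m mulr0n subr0 scale0r.
Qed.

Definition nested x := forall m,
  x m m = 0 /\ (col_border m x = 0 \/ row_border m x = 0).

Lemma nested_exprS x m (k : nat) : nested x ->
  corner m.+1 x ^+ k.+1 = corner m x ^+ k.+1 +
    corner m x ^+ k * col_border m x + row_border m x * corner m x ^+ k.
Proof.
move=> /(_ m)[xmm bc0]; rewrite cornerS xmm scale0r addr0.
exact: half_border_exprS.
Qed.

Lemma corner0 x : corner 0 x = 0.
Proof. by rewrite /corner /cproj pid_mx_0 mulr0. Qed.

(** Every term of [nested_exprS] with [k = m] contains [corner m x ^+ m]. The exception is there
    because [corner 0 x ^+ 0] is 1 in the padded ring. *)
Lemma nested_nilpotent x (m : nat) : nested x -> (m <= n.+1)%N ->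
  corner m x ^+ m = 0 \/ m = 0%N.
Proof.
move=> nst; elim: m => [|m IHm] lt_mn; [by right | left].
have -> : m = Ordinal lt_mn by [].
rewrite nested_exprS //=; case: (IHm (ltnW lt_mn)) => [xm0|m0].
  by rewrite exprS xm0 !(mulr0, mul0r, addr0).
have Pm0 : cproj F n m = 0 by rewrite m0 /cproj pid_mx_0.
by rewrite /col_border /row_border /corner /= Pm0 exprS !(mulr0, mul0r, addr0).
Qed.

(** The trace of the next corner gives [x m m = 0]. The traces of its higher powers then kill the
    products [c * A ^+ j * b] one after another, and [bordered_dependent] excludes two nonzero
    borders. *)
Lemma sreg_border x m : Phi_zero x -> cpow_free x ->
    corner m x ^+ m = 0 -> (0 < m)%N ->
  x m m = 0 /\ (col_border m x = 0 \/ row_border m x = 0).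
Proof.
move=> Phi0 cfree; have:= ltn_ord m; move: (erefl (nat_of_ord m)).
case: {2 3 4 6}(nat_of_ord m) => // k def_m lt_kn; rewrite def_m => xk0 _.
have PhiC (i j : nat) : (j <= i)%N -> (i <= n)%N -> \tr (corner i.+1 x ^+ j.+1) = 0.
  move=> le_ji le_in; have := Phi0 (inord i) (inord j).
  by rewrite fij_corner !inordK ?ltnS ?(leq_trans le_ji) //; apply.
have xmm : x m m = 0.
  have := PhiC m 0 isT (ltnSE (ltn_ord m)); rewrite cornerS expr1 !mxtraceD.
  rewrite -[col_border m x]mul1r -(expr0 (corner m x)) mxtrace_corner_col.
  rewrite -[row_border m x]mulr1 -(expr0 (corner m x)) mxtrace_row_corner.
  have := PhiC k 0 isT (ltnW lt_kn); rewrite -def_m expr1 => ->; rewrite !add0r.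
  rewrite mxtraceZ [\tr _](_ : _ = 1) ?mulr1 // /mxtrace (bigD1 m) //= big1.
    by rewrite mxE !eqxx addr0.
  by move=> a neq_am; rewrite mxE (negPf neq_am).
split=> //; set b := col_border m x; set c := row_border m x.
pose A := corner m x; have Ak0 : A ^+ k.+1 = 0 by rewrite /A def_m.
have Aj0 j : (k < j)%N -> A ^+ j = 0.
  by move=> lt_kj; rewrite -(subnKC lt_kj) exprD Ak0 mul0r.
have cAb j : c * A ^+ j * b = 0.
  elim/ltn_ind: j => j IHj.
  (* [Phi_zero] controls the trace of the power [j.+2] of a corner of size [k.+2] for [j <= k] only;
     beyond that [A ^+ j] is already 0. *)
  have [lt_jk|le_kj] := ltnP j k.+1; last first.
    by rewrite Aj0 // mulr0 mul0r.
  apply: row_corner_col_eq0; rewrite -/A -/b -/c.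
  have := bordered_mxtrace (cproj_corner m x) (corner_cproj m x)
    (cproj_col m x) (col_cproj m x) (cproj_row m x) (row_cproj m x) IHj.
  have -> : A + b + c = corner m.+1 x by rewrite cornerS xmm scale0r addr0.
  rewrite PhiC; [|by rewrite def_m | by rewrite -ltnS].
  rewrite -/A -/b -/c => /esym/eqP.
  have -> : \tr (A ^+ j.+2) = 0.
    have [lt_jk1|le_kj] := ltnP j k; first by rewrite /A def_m PhiC // ltnW.
    by rewrite Aj0 ?mxtrace0 // (leq_ltn_trans le_kj) // ltnW.
  by rewrite add0r -mulr_natl mulf_eq0 pnatr_eq0 /= => /eqP.
have [->|b_neq0] := eqVneq b 0; [by left | right].
apply/eqP; apply: contraT => c_neq0; exfalso.
have rankP : \rank (cproj F n m) = k.+1.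
  by rewrite def_m rank_pid_mx // ltnW.
have PAk : cproj F n m * A ^+ k != 0.
  by rewrite -/(cpow m k x) def_m cpow_free_neq0 // ltnW.
have [d] := bordered_dependent (cproj_id F n m) (cproj_corner m x)
  (corner_cproj m x) (cproj_col m x) (col_cproj m x) (cproj_row m x)
  (row_cproj m x) rankP Ak0 cAb PAk b_neq0 c_neq0.
have -> : A + b + c = corner m.+1 x by rewrite cornerS xmm scale0r addr0.
rewrite -cpowS def_m; exact: (cpow_free_indep cfree).
Qed.

(** Nilpotency of the corner is carried through the induction because [sreg_border] asks for it at
    the next index. *)
Lemma sreg_nested x : Phi_zero x -> cpow_free x -> nested x.
Proof.
move=> Phi0 cfree.
suff nst (m : nat) (lt_mn : (m < n.+1)%N) : corner m.+1 x ^+ m.+1 = 0 /\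
    (x (Ordinal lt_mn) (Ordinal lt_mn) = 0 /\
    (col_border (Ordinal lt_mn) x = 0 \/ row_border (Ordinal lt_mn) x = 0)).
  by case=> m lt_mn; case: (nst m lt_mn).
elim: m lt_mn => [|m IHm] lt_mn.
  have b0 : col_border (Ordinal lt_mn) x = 0.
    by rewrite /col_border /cproj pid_mx_0 !mul0r.
  have c0 : row_border (Ordinal lt_mn) x = 0.
    by rewrite /row_border /cproj pid_mx_0 !mulr0.
  have: fij (Ordinal lt_mn) (Ordinal lt_mn) x = 0 by exact: Phi0.
  rewrite fij_corner expr1 /= -[0%N]/(nat_of_ord (Ordinal lt_mn)) cornerS b0 c0 corner0 !add0r.
  rewrite mxtraceZ [\tr _](_ : _ = 1) ?mulr1; last first.
    rewrite /mxtrace (bigD1 (Ordinal lt_mn)) //= big1.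
      by rewrite mxE !eqxx addr0.
    by move=> a neq_am; rewrite mxE (negPf neq_am).
  by move=> ->; rewrite scale0r; split=> //; split=> //; left.
have [xm0 _] := IHm (ltnW lt_mn).
have [xmm bc0] := @sreg_border x (Ordinal lt_mn) Phi0 cfree xm0 isT.
split=> //; rewrite -[m.+1]/(nat_of_ord (Ordinal lt_mn)) cornerS xmm scale0r addr0.
by rewrite half_border_exprS //= exprS xm0 !(mulr0, mul0r, addr0).
Qed.

(** The border terms of [nested_exprS] are traceless, so the traces of powers descend to the empty
    corner. *)
Lemma nested_Phi_zero x : nested x -> Phi_zero x.
Proof.
move=> nst i j _; rewrite fij_corner; have: (i.+1 <= n.+1)%N by [].
move: (i : nat) => m lt_mn {i}; move: {j}(j : nat) => j.
elim: m lt_mn => [|m IHm] lt_mn.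
  rewrite -[0%N]/(nat_of_ord (Ordinal lt_mn)) nested_exprS // !mxtraceD.
  by rewrite mxtrace_corner_col mxtrace_row_corner corner0 exprS mul0r mxtrace0 !addr0.
rewrite -[m.+1]/(nat_of_ord (Ordinal lt_mn)) nested_exprS // !mxtraceD.
by rewrite mxtrace_corner_col mxtrace_row_corner IHm ?addr0 // ltnW.
Qed.

Lemma corner_exp_cproj (m k : nat) x : corner m x ^+ k * cproj F n m = cpow m k x.
Proof.
rewrite /cpow; case: k => [|k]; first by rewrite expr0 mul1r mulr1.
by rewrite {1}exprSr -mulrA corner_cproj -exprSr exprS mulrA cproj_corner.
Qed.

Lemma nested_cpow_eq0S x m (k : nat) : nested x -> nat_of_ord m = k.+1 ->
  cpow m k x = 0 -> cpow m.+1 k.+1 x = 0.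
Proof.
move=> nst def_m xm0; rewrite cpowS nested_exprS //.
have -> : corner m x ^+ k.+1 = 0.
  by rewrite exprSr -{2}(cproj_corner m x) mulrA corner_exp_cproj xm0 mul0r.
rewrite -cproj_col mulrA corner_exp_cproj xm0 mul0r.
by rewrite -row_cproj -mulrA -/(cpow m k x) xm0 mulr0 !addr0.
Qed.

(** If the top power of some corner were zero, the vanishing would pass from corner to corner up to
    [x ^+ n]. *)
Lemma nested_cpow_neq0 x (m : nat) :
  nested x -> x ^+ n != 0 -> (m <= n)%N -> cpow m.+1 m x != 0.
Proof.
move=> nst xn le_mn; apply: contraNneq xn => xm0.
suff xk0 k : (m + k <= n)%N -> cpow (m + k).+1 (m + k) x = 0.
  have := xk0 (n - m)%N; rewrite subnKC // => /(_ (leqnn _)).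
  by rewrite /cpow cproj_full mul1r corner_full => ->.
elim: k => [|k IHk]; rewrite ?addn0 // addnS => lt_mkn.
have := @nested_cpow_eq0S x (Ordinal (lt_mkn : ((m + k).+1 < n.+1)%N)) (m + k)%N nst.
by move=> /(_ erefl) /=; apply; apply: IHk; apply: ltnW.
Qed.

(** Corners are peeled off from the largest, of size [m.+1]. The part [S] of a relation due to
    smaller corners is killed by [unit_proj] on both sides, hence so is the rest [D]. On one side
    the top power of the largest corner survives [unit_proj], and [nilpotent_powers_free] makes the
    coefficients of [D] vanish. *)
Lemma nested_cpow_free x : nested x -> x ^+ n != 0 -> cpow_free x.
Proof.
move=> nst xn c.
suff H (m : nat) : (m <= n.+1)%N ->
    \sum_(i < m) \sum_(j < i.+1) c i j *: cpow i.+1 j x = 0 ->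
    forall i j : nat, (j <= i)%N -> (i < m)%N -> c i j = 0.
  by move=> c0 i j le_ji le_in; apply: (H n.+1).
elim: m => // m IHm lt_mn; rewrite big_ord_recr /=.
pose mo := Ordinal lt_mn.
set S := \sum_(i < m) _; set D := \sum_(j < m.+1) _ => SD0.
have le_im i : (i < m)%N -> cproj F n i.+1 * cproj F n m = cproj F n i.+1.
  move=> lt_im; rewrite -[RHS](pid_mx_minh F n.+1 n.+1 i.+1).
  by rewrite [LHS]mul_pid_mx; congr pid_mx; lia.
have le_mi i : (i < m)%N -> cproj F n m * cproj F n i.+1 = cproj F n i.+1.
  move=> lt_im; rewrite -[RHS](pid_mx_minh F n.+1 n.+1 i.+1).
  by rewrite [LHS]mul_pid_mx; congr pid_mx; lia.
have SU : S * unit_proj F mo = 0.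
  rewrite mulr_suml big1 // => i _; rewrite mulr_suml big1 // => j _.
  rewrite -mulmxE -scalemxAl mulmxE -cpow_cproj -(le_im _ (ltn_ord i)) -2!mulrA.
  by rewrite [cproj F n m]/(cproj F n mo) cproj_unit !mulr0 scaler0.
have US : unit_proj F mo * S = 0.
  rewrite mulr_sumr big1 // => i _; rewrite mulr_sumr big1 // => j _.
  rewrite -mulmxE -scalemxAr mulmxE -cproj_cpow -(le_mi _ (ltn_ord i)).
  rewrite -[_ * _ * cpow _ _ _]mulrA [X in _ *: X]mulrA.
  by rewrite [cproj F n m]/(cproj F n mo) unit_cproj !mul0r scaler0.
have DU : D * unit_proj F mo = 0.
  by move/(congr1 (fun M => M * unit_proj F mo)): SD0; rewrite mulrDl SU add0r mul0r.
have UD : unit_proj F mo * D = 0.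
  by move/(congr1 (fun M => unit_proj F mo * M)): SD0; rewrite mulrDr US add0r mulr0.
suff cm0 j : (j <= m)%N -> c m j = 0.
  have S0 : S = 0.
    rewrite -[RHS]SD0 /D big1 ?addr0 // => j _.
    by rewrite cm0 ?scale0r // -ltnS.
  move=> i j le_ji; rewrite ltnS leq_eqVlt => /predU1P[eq_im|lt_im].
    by rewrite eq_im cm0 // -eq_im.
  exact: (IHm (ltnW lt_mn) S0).
pose A := corner m.+1 x.
have Am1 : A ^+ m.+1 = 0 by case: (nested_nilpotent nst lt_mn).
have Ampow : cpow m.+1 m x != 0 by apply: nested_cpow_neq0.
(* As one border vanishes, the top power lives entirely in row [m] or in column [m]. For [m = 0] it
   is the power zero, that is, the projection itself. *)
have key : unit_proj F mo * cpow m.+1 m x != 0 \/ cpow m.+1 m x * unit_proj F mo != 0.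
  have Am0 := nested_nilpotent nst (ltnW lt_mn); have [_ bc0] := nst mo.
  case: (posnP m) => [m0|m_gt0].
    left; suff -> : cpow m.+1 m x = unit_proj F mo.
      rewrite unit_proj_id; apply/eqP => /matrixP/(_ mo mo)/eqP.
      by rewrite !mxE !eqxx oner_eq0.
    rewrite /cpow [X in _ ^+ X]m0 expr0 mulr1 -[m.+1]/(mo.+1) cprojS.
    by rewrite {1}/cproj /= m0 pid_mx_0 add0r.
  case: Am0 => [Am0|m0]; last by rewrite m0 in m_gt0.
  have xm : cpow m.+1 m x = corner m x ^+ m.-1 * col_border mo x +
                            row_border mo x * corner m x ^+ m.-1.
    rewrite -{2}(prednK m_gt0) cpowS -[m.+1]/(mo.+1) nested_exprS //=.
    by rewrite (prednK m_gt0) Am0 add0r.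
  case: bc0 => bc0; [left | right].
    suff -> : unit_proj F mo * cpow m.+1 m x = cpow m.+1 m x by [].
    by rewrite xm bc0 mulr0 add0r mulrA unit_row.
  suff -> : cpow m.+1 m x * unit_proj F mo = cpow m.+1 m x by [].
  by rewrite xm bc0 mul0r addr0 -mulrA col_unit.
have UDE : unit_proj F mo * D =
    \sum_(k < m.+1) c m k *: ((unit_proj F mo * cproj F n m.+1) *m A ^+ k).
  rewrite /D mulr_sumr; apply: eq_bigr => k _.
  by rewrite -!mulmxE -scalemxAr !mulmxE /cpow mulrA.
have DUE : (D * unit_proj F mo)^T =
    \sum_(k < m.+1) c m k *: ((cproj F n m.+1 * unit_proj F mo)^T *m A^T ^+ k).
  rewrite /D mulr_suml raddf_sum /=; apply: eq_bigr => k _.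
  rewrite -trmxX -trmx_mul [_ ^+ _ *m _]mulrA corner_exp_cproj.
  by rewrite -mulmxE -scalemxAl linearZ.
case: key => key.
  apply: (@nilpotent_powers_free F n A n.+1 m (unit_proj F mo * cproj F n m.+1) (c m)).
  - by rewrite Am1 mulmx0.
  - by rewrite mulmxE -mulrA.
  exact: (etrans (esym UDE) UD).
apply: (@nilpotent_powers_free F n A^T n.+1 m (cproj F n m.+1 * unit_proj F mo)^T (c m)).
- by rewrite -trmxX Am1 trmx0 mulmx0.
- rewrite -trmxX -trmx_mul mulmxE mulrA corner_exp_cproj.
  by apply: contraNneq key => /(congr1 trmx); rewrite trmxK trmx0 => ->.
by apply: (etrans (esym DUE)); rewrite DU trmx0.
Qed.

Theorem sregP x : Phi_zero_sreg x <-> nested x /\ x ^+ n != 0.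
Proof.
rewrite /Phi_zero_sreg strongly_regularP; split=> [[Phi0 cfree]|[nst xn]].
  split; first exact: sreg_nested.
  have := @cpow_free_neq0 x n.+1 n cfree (leqnn _) (leqnn _).
  by rewrite /cpow cproj_full mul1r corner_full.
by split; [apply: nested_Phi_zero | apply: nested_cpow_free].
Qed.

End StronglyRegular.

(* The total order on indices in which each [b] is inserted above all smaller
   indices if [t b], and below all of them otherwise. *)
Definition prec (t : nat -> bool) (a b : nat) : bool :=
  if (a < b)%N then t b else (b < a)%N && ~~ t a.

(** * Matrices triangular for an insertion order on the indices *)

Section NestedOrder.
Variable t : nat -> bool.

Lemma prec_irr (a : nat) : prec t a a = false.
Proof. by rewrite /prec ltnn. Qed.

Lemma prec_trans : transitive (prec t).
Proof.
move=> b a c; rewrite /prec.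
case: (ltngtP a b) => ab; case: (ltngtP b c) => bc; case: (ltngtP a c) => ac;
  subst => //=; try lia; by case: (t _) => //; case: (t _).
Qed.

Lemma prec_total (a b : nat) : a != b -> prec t a b || prec t b a.
Proof. by rewrite /prec; case: ltngtP => //=; case: (t _). Qed.

Variable n : nat.
Implicit Types a b : 'I_n.+1.

(** The rank of [a] in the order: permuting the indices by [pos] makes triangularity for [prec] the
    usual upper triangularity. *)
Definition pos a : nat := #|[set b : 'I_n.+1 | prec t b a]|.

Lemma pos_lt a b : prec t a b -> (pos a < pos b)%N.
Proof.
move=> ab; apply: proper_card; apply/properP; split.
  by apply/subsetP => c; rewrite !inE => /prec_trans; apply.
by exists a; rewrite !inE // prec_irr.
Qed.

Lemma pos_inj : injective pos.
Proof.
move=> a b eq_ab; apply/eqP; apply: contraT => neq_ab.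
by case/orP: (prec_total neq_ab) => /pos_lt; rewrite eq_ab ltnn.
Qed.

Lemma prec_pos a b : prec t a b = (pos a < pos b)%N.
Proof.
apply/idP/idP => [/pos_lt //|lt_ab].
have neq_ab : a != b :> nat by apply: contraTneq lt_ab => /val_inj ->; rewrite ltnn.
by case/orP: (prec_total neq_ab) => // /pos_lt; rewrite ltnNge ltnW.
Qed.

Lemma ltn_pos a : (pos a < n.+1)%N.
Proof.
rewrite -[n.+1]card_ord -cardsT; apply: proper_card; apply/properP.
by split; [apply/subsetP | exists a; rewrite inE ?prec_irr].
Qed.

Lemma pos_surj (k : nat) : (k < n.+1)%N -> exists a, pos a = k.
Proof.
move=> lt_kn; pose f a := Ordinal (ltn_pos a).
have f_inj : injective f by move=> a b [/pos_inj].
by have [g fK gK] := injF_bij f_inj; exists (g (Ordinal lt_kn)); have [] := gK (Ordinal lt_kn).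
Qed.

Variable F : numFieldType.
Implicit Types x y : 'M[F]_n.+1.

Definition strict_tri x := forall a b, ~~ prec t a b -> x a b = 0.
Definition weak_tri x := forall a b, (pos b < pos a)%N -> x a b = 0.

Lemma strict_triP x : strict_tri x <-> (forall a b, (pos b <= pos a)%N -> x a b = 0).
Proof. by split=> x0 a b lt_ba; apply: x0; move: lt_ba; rewrite prec_pos -leqNgt. Qed.

Lemma strict_weak x : strict_tri x -> weak_tri x.
Proof. by move/strict_triP => x0 a b lt_ba; apply: x0; apply: ltnW. Qed.

(** Each factor [x] raises the position by at least one. *)
Lemma strict_tri_exp x (k : nat) a b :
  strict_tri x -> (pos b < pos a + k)%N -> (x ^+ k) a b = 0.
Proof.
move/strict_triP => x0; elim: k b => [|k IHk] b lt_ba.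
  by rewrite expr0 mxE; case: eqP lt_ba => // ->; rewrite addn0 ltnn.
rewrite exprSr -mulmxE mxE big1 // => c _.
have [lt_cb|le_bc] := ltnP (pos c) (pos b); last by rewrite x0 ?mulr0.
by rewrite IHk ?mul0r //; lia.
Qed.

Lemma strict_tri_nilpotent x : strict_tri x -> x ^+ n.+1 = 0.
Proof.
move=> x0; apply/matrixP => a b; rewrite strict_tri_exp ?mxE //.
by rewrite (leq_trans (ltn_pos b)) ?leq_addl.
Qed.

(** Between positions at distance [k] there is a single chain of [k] strict steps, so the entry is a
    product of entries of [x] at covers. *)
Lemma cover_exp_neq0 x (k : nat) a b : strict_tri x ->
    (forall c d, pos d = (pos c).+1 -> x c d != 0) ->
  pos b = (pos a + k)%N -> (x ^+ k) a b != 0.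
Proof.
move=> x0 xcov; elim: k b => [|k IHk] b def_b.
  by rewrite addn0 in def_b; rewrite expr0 (pos_inj def_b) mxE eqxx oner_eq0.
have [|c def_c] := @pos_surj (pos a + k)%N.
  by rewrite (leq_trans _ (ltn_pos b)) // def_b ltnS addnS.
rewrite exprSr -mulmxE mxE (bigD1 c) //= big1 ?addr0 => [|d neq_dc].
  by rewrite mulf_neq0 ?IHk // xcov // def_b def_c addnS.
have [lt_dc|le_cd] := ltnP (pos d) (pos c).
  by rewrite strict_tri_exp ?mul0r // -def_c.
move/strict_triP: x0 => ->; rewrite ?mulr0 //.
have: pos c != pos d by apply: contra_neq neq_dc => /pos_inj.
lia.
Qed.

Lemma cover_neq0_exp_neq0 x : strict_tri x ->
  (forall c d, pos d = (pos c).+1 -> x c d != 0) -> x ^+ n != 0.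
Proof.
move=> x0 xcov; have [//|a a0] := @pos_surj 0; have [//|b bn] := @pos_surj n.
have := @cover_exp_neq0 x n a b x0 xcov; rewrite a0 bn => /(_ erefl).
by apply: contra_neq => ->; rewrite mxE.
Qed.

Lemma exists_strict_tri_reg : exists x, strict_tri x /\ x ^+ n != 0.
Proof.
(* The nilpotent Jordan block for the order. *)
pose x : 'M[F]_n.+1 := \matrix_(a, b) (pos b == (pos a).+1)%:R.
have x0 : strict_tri x.
  by apply/strict_triP => a b le_ba; rewrite mxE ltn_eqF.
by exists x; split=> //; apply: cover_neq0_exp_neq0 => // c d def_d; rewrite mxE def_d eqxx oner_eq0.
Qed.

End NestedOrder.

(** * One-sided borders amount to strict triangularity for some order *)

Section NestedTriangular.
Variables (F : numFieldType) (n : nat).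
Implicit Types (x : 'M[F]_n.+1) (m : 'I_n.+1).

Lemma row_border_eq0 m x :
  row_border m x = 0 <-> (forall a : 'I_n.+1, (a < m)%N -> x m a = 0).
Proof.
have rowE a b : row_border m x a b = (x m b *+ (a == m)) *+ (b < m)%N.
  rewrite Mcproj -mulmxE mxE (bigD1 m) //= big1 ?addr0 => [|j neq_jm].
    by rewrite mxE eqxx andbT mulr_natl.
  by rewrite mxE (negPf neq_jm) andbF mul0r.
split=> [/matrixP r0 a lt_am|r0]; first by have := r0 m a; rewrite rowE mxE eqxx lt_am.
apply/matrixP => a b; rewrite rowE mxE.
by case: ltnP => [/r0 ->|_]; rewrite ?mul0rn.
Qed.

Lemma col_border_eq0 m x :
  col_border m x = 0 <-> (forall a : 'I_n.+1, (a < m)%N -> x a m = 0).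
Proof.
have colE a b : col_border m x a b = (x a m *+ (a < m)%N) *+ (b == m).
  rewrite /col_border -mulmxE mxE (bigD1 m) //= big1 ?addr0 => [|j neq_jm].
    by rewrite cprojM mxE eqxx /= mulr_natr.
  by rewrite [unit_proj _ _ _ _]mxE (negPf neq_jm) mulr0.
split=> [/matrixP r0 a lt_am|r0]; first by have := r0 a m; rewrite colE mxE eqxx lt_am.
apply/matrixP => a b; rewrite colE mxE.
by case: ltnP => [/r0 ->|_]; rewrite !mul0rn.
Qed.

Lemma nestedP x : nested x <-> exists t, strict_tri t x.
Proof.
split=> [nst|[t x0] m]; last first.
  split; first by rewrite x0 // prec_irr.
  case tm: (t m); [right; apply/row_border_eq0 | left; apply/col_border_eq0];
    by move=> a lt_am; rewrite x0 // /prec lt_am ?tm // ltnNge ltnW.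
(* An index goes above the smaller ones exactly when its row border vanishes; otherwise its column
   border does. *)
exists (fun k => row_border (inord k) x == 0) => a b; rewrite /prec !inord_val.
have [lt_ab|lt_ba|/val_inj <-] := ltngtP a b => /=; last by case: (nst a).
- by case: (nst b) => _ [/col_border_eq0 ->|->] //; rewrite eqxx.
- by rewrite negbK => /eqP/row_border_eq0 ->.
Qed.

(* Opposite insertions of [m] force both borders of [m] to vanish, so that the
   [m]-th power of the next corner is zero. *)
Lemma strict_tri_order t t' x (m : nat) :
    strict_tri t x -> strict_tri t' x -> x ^+ n != 0 -> (0 < m)%N -> (m <= n)%N ->
  t m = t' m.
Proof.
move=> xt xt' xn m_gt0 le_mn.
have nst : nested x by apply/nestedP; exists t.
wlog: t t' xt xt' / t m && ~~ t' m => [H|/andP[tm t'm]].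
  case tm: (t m); case tm': (t' m) => //.
    by rewrite -tm -tm'; apply: H => //; rewrite tm tm'.
  by rewrite -tm -tm'; apply/esym; apply: H => //; rewrite tm tm'.
have [] := negP (nested_cpow_neq0 nst xn le_mn); apply/eqP.
pose mo : 'I_n.+1 := Ordinal (le_mn : (m < n.+1)%N).
have r0 : row_border mo x = 0.
  apply/row_border_eq0 => a lt_am; apply: xt.
  by rewrite /prec lt_am ltnNge ltnW //= tm.
have c0 : col_border mo x = 0.
  by apply/col_border_eq0 => a lt_am; apply: xt'; rewrite /prec lt_am.
have [xm0|m0] := nested_nilpotent nst (ltnW (ltn_ord mo)); last by rewrite [m]m0 in m_gt0.
rewrite -{2}(prednK m_gt0) cpowS -[m.+1]/(mo.+1) nested_exprS // r0 c0 mulr0 mul0r !addr0.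
by rewrite prednK.
Qed.

End NestedTriangular.

(** * Regularity of strictly triangular matrices *)

Section Regular.
Variables (F : numFieldType) (n : nat).
Implicit Types x y : 'M[F]_n.+1.

Lemma mem_cent1P x y : reflect (x *m y = y *m x) (y \in 'C(mxvec x))%MS.
Proof.
apply: (iffP cent_mxP) => [Cy|xy A]; first exact/Cy/submx_refl.
by case/sub_rVP => k /(congr1 vec_mx); rewrite linearZ /= !mxvecK => ->;
  rewrite -scalemxAl xy scalemxAr.
Qed.

(** By [nilpotent_centralizer] with [P = 1], the centralizer is spanned by the first [n.+1] powers
    of [x], which are free. *)
Lemma nilpotent_regular x : x ^+ n.+1 = 0 -> x ^+ n != 0 -> regular x.
Proof.
move=> xn1 xn; have powE (w : 'rV_n.+1) :
    w *m powers_mx x n.+1 = mxvec (\sum_(k < n.+1) w 0 (inord k) *: (1%:M *m x ^+ k)).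
  rewrite mulmx_sum_row linear_sum /=; apply: eq_bigr => k _.
  by rewrite rowK linearZ /= mul1mx inord_val.
suff eqC : ('C(mxvec x) == powers_mx x n.+1)%MS.
  rewrite /regular (eqmx_rank eqC); apply/eqP/inj_row_free => w.
  rewrite powE => /(congr1 vec_mx); rewrite mxvecK linear0 => w0.
  apply/rowP => k; rewrite mxE -[k]inord_val.
  apply: (@nilpotent_powers_free F n x n.+1 n 1%:M (fun k => w 0 (inord k)) _ _ w0);
    by rewrite ?mul1mx // -ltnS.
apply/andP; split; last first.
  apply/row_subP => k; rewrite rowK; apply/mem_cent1P.
  by rewrite mulmxE -exprS exprSr.
apply/row_subP => i; rewrite -[row i _]vec_mxK; set y := vec_mx _.
have /mem_cent1P xy : (y \in 'C(mxvec x))%MS by rewrite vec_mxK row_sub.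
have xn' : 1%:M *m x ^+ n != 0 by rewrite mul1mx.
have [d ->] := @nilpotent_centralizer F n x n 1%:M (mxrank1 _ _)
  (mulmx1 _) (mulmx1 _) (mul1mx _) y xn1 xn' (mul1mx _) (mulmx1 _) xy.
apply/submxP; exists (\row_k d k); rewrite powE.
by congr mxvec; apply: eq_bigr => k _; rewrite mxE inord_val.
Qed.

Implicit Types Q : {set 'I_n.+1 * 'I_n.+1}.

(** The space of matrices supported on [Q], as a row space, so that rank arguments apply. *)
Definition pair_span Q :=
  \matrix_(i < #|Q|) mxvec (delta_mx (enum_val i).1 (enum_val i).2 : 'M[F]_n.+1).

Lemma rank_pair_span Q : \rank (pair_span Q) = #|Q|.
Proof.
apply/eqP/inj_row_free => w; rewrite mulmx_sum_row => w0; apply/rowP => i.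
rewrite mxE; move/(congr1 vec_mx): w0; rewrite linear_sum linear0 /=.
move/matrixP/(_ (enum_val i).1 (enum_val i).2); rewrite mxE summxE (bigD1 i) //=.
rewrite rowK linearZ /= mxvecK !mxE !eqxx mulr1 big1 ?addr0 // => j neq_ji.
rewrite rowK linearZ /= mxvecK !mxE.
case: eqP => [eq1|_]; last by rewrite mulr0.
case: eqP => [eq2|_]; last by rewrite mulr0.
case/eqP: neq_ji; apply: enum_val_inj.
by rewrite [enum_val i]surjective_pairing eq1 eq2 -surjective_pairing.
Qed.

Lemma sub_pair_span Q y :
  (forall a b, (a, b) \notin Q -> y a b = 0) -> (mxvec y <= pair_span Q)%MS.
Proof.
move=> y0; rewrite (matrix_sum_delta y) linear_sum summx_sub // => a _.
rewrite linear_sum summx_sub // => b _; rewrite linearZ /=.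
have [Qab|/y0 ->] := boolP ((a, b) \in Q); last by rewrite scale0r sub0mx.
rewrite scalemx_sub //; have := row_sub (enum_rank_in Qab (a, b)) (pair_span Q).
by rewrite rowK enum_rankK_in.
Qed.

(** The sets differ by the [n.+1] diagonal pairs and by [(c, d)]. These are the dimensions of the
    Borel subalgebra and of a hyperplane of its nilradical. *)
Lemma card_weak_pairs (t : nat -> bool) (c d : 'I_n.+1) : pos t d = (pos t c).+1 ->
  #|[set u : 'I_n.+1 * 'I_n.+1 | (pos t u.1 <= pos t u.2)%N]| =
  (#|[set u : 'I_n.+1 * 'I_n.+1 | (pos t u.1 < pos t u.2)%N && (u != (c, d))]| + n.+2)%N.
Proof.
move=> cov_cd; rewrite (cardsD1 (c, d)) inE /= cov_cd leqnSn add1n addnS; congr _.+1.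
have cardD : n.+1 = #|[set (a, a) | a : 'I_n.+1]|.
  by rewrite card_imset ?card_ord // => a b [].
rewrite [X in (_ + X)%N]cardD -cardsUI [X in (_ + #|pred_of_set X|)%N](_ : _ = set0) ?cards0 ?addn0.
  apply: eq_card => -[a b]; rewrite !inE /=.
  apply/andP/orP => [[neq_cd le_ab]|[/andP[lt_ab neq_cd]|/imsetP[e _ [-> ->]]]].
  - rewrite leq_eqVlt in le_ab; case/orP: le_ab => [/eqP/pos_inj ->|lt_ab].
      by right; apply: imset_f.
    by left; rewrite lt_ab.
  - by split=> //; apply: ltnW.
  split=> //; apply: contraTneq isT => -[ec ed].
  by move: cov_cd; rewrite -ec -ed => /eqP; rewrite ltn_eqF.
apply/setP => -[a b]; rewrite !inE /=; apply: contraTF isT.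
by case/andP => /andP[lt_ab _] /imsetP[e _ [ea eb]]; rewrite ea eb ltnn in lt_ab.
Qed.

(* If a simple root entry vanishes then [ad x] maps the Borel subalgebra into a
   hyperplane of its nilradical, so the centralizer has dimension > n.+1. *)
Lemma regular_cover_neq0 (t : nat -> bool) x (c d : 'I_n.+1) :
  strict_tri t x -> regular x -> pos t d = (pos t c).+1 -> x c d != 0.
Proof.
move=> /strict_triP x0 reg_x cov_cd; apply/eqP => xcd0.
have := card_weak_pairs cov_cd; set Q1 := [set u | _]; set Q2 := [set u | _] => cardQ.
pose B := lin_mulmx x - lin_mulmxr x.
have adE y : mxvec y *m B = mxvec (x *m y - y *m x).
  by rewrite mulmxBr !mul_vec_lin /= linearB.
have sQ12 : (pair_span Q1 *m B <= pair_span Q2)%MS.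
  apply/row_subP => i; rewrite row_mul rowK adE.
  case: (enum_val i) (enum_valP i) => a b; rewrite inE /= => le_ab.
  apply: sub_pair_span => i' j'; rewrite inE /= => /nandP notQ2.
  have xd : (x *m delta_mx a b) i' j' = x i' a *+ (j' == b).
    rewrite mxE (bigD1 a) //= big1 => [|k neq_ka]; rewrite mxE ?eqxx /=.
      by rewrite addr0 mulr_natr.
    by rewrite (negPf neq_ka) mulr0.
  have dx : (delta_mx a b *m x) i' j' = x b j' *+ (i' == a).
    rewrite mxE (bigD1 b) //= big1 => [|k neq_kb]; rewrite mxE ?eqxx /= ?andbT.
      by rewrite addr0 mulr_natl.
    by rewrite (negPf neq_kb) andbF mul0r.
  rewrite mxE xd mxE dx.
  (* Above the diagonal, [(c, d)] is the only pair outside [Q2]. As [d] covers [c], each term of the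
     commutator entry there is either [x c d] up to sign or 0 by strict triangularity. *)
  have [lt_ij|le_ji] := ltnP (pos t i') (pos t j').
    case: notQ2; rewrite ?lt_ij // negbK => /eqP[-> ->].
    have -> : x c a *+ (d == b) = 0.
      case: eqP => // db; have [lt_ca|le_ac] := ltnP (pos t c) (pos t a); last by rewrite x0.
      have -> : a = d; last by rewrite xcd0.
      by apply: (@pos_inj t); apply/eqP; rewrite eqn_leq {1}db le_ab cov_cd.
    rewrite sub0r; case: eqP => [ca|_]; last by rewrite oppr0.
    have [lt_bd|le_db] := ltnP (pos t b) (pos t d); last by rewrite x0 ?oppr0.
    suff -> : b = c by rewrite xcd0 oppr0.
    by apply: (@pos_inj t); apply/eqP; rewrite eqn_leq {2}ca le_ab andbT -ltnS -cov_cd.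
  have -> : x i' a *+ (j' == b) = 0.
    by case: eqP => // jb; rewrite x0 // (leq_trans le_ab) // -jb.
  rewrite sub0r; case: eqP => [ia|_]; last by rewrite oppr0.
  by rewrite x0 ?oppr0 // (leq_trans le_ji) // ia.
have sKC : (pair_span Q1 :&: kermx B <= 'C(mxvec x))%MS.
  apply: submx_trans (capmxSr _ _) _; apply/row_subP => i; rewrite -[row i _]vec_mxK; set y := vec_mx _.
  have : (mxvec y <= kermx B)%MS by rewrite vec_mxK row_sub.
  move/sub_kermxP; rewrite adE => /(congr1 vec_mx); rewrite mxvecK linear0 => /eqP.
  by rewrite subr_eq0 => /eqP/mem_cent1P.
(* Rank and nullity give [#|Q1| <= #|Q2| + n.+1], one less than the count allows. *)
have := mxrank_mul_ker (pair_span Q1) B; rewrite rank_pair_span.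
have := mxrankS sQ12; rewrite rank_pair_span.
have := mxrankS sKC; rewrite reg_x => le1 le2 eq12.
have := leq_add le2 le1; rewrite eq12 [X in (X <= _)%N]cardQ leq_add2l.
by rewrite ltnn.
Qed.

Lemma strict_tri_regular (t : nat -> bool) x : strict_tri t x ->
  (regular x <-> x ^+ n != 0).
Proof.
move=> xt; split=> [reg_x|xn].
  by apply: (cover_neq0_exp_neq0 xt) => c d; apply: regular_cover_neq0.
by apply: nilpotent_regular xn; apply: strict_tri_nilpotent xt.
Qed.

End Regular.

(** * Borel subalgebras in the two orbits, seen through the last row and column *)

Section BorelOrbits.
Variables (F : numFieldType) (m : nat) (sgn : bool) (B : 'M[F]_m.+1 -> Prop).
Hypothesis BQ : in_Q sgn B.

Let E : 'M[F]_m.+1 := unit_proj F ord_max.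

Lemma mul_unit_projlE (z : 'M[F]_m.+1) a b : (E * z) a b = z ord_max b *+ (a == ord_max).
Proof.
rewrite -mulmxE mxE (bigD1 ord_max) //= big1 ?addr0 => [|c neq_c].
  by rewrite mxE eqxx andbT mulr_natl.
by rewrite mxE (negPf neq_c) andbF mul0r.
Qed.

Lemma mul_unit_projrE (z : 'M[F]_m.+1) a b : (z * E) a b = z a ord_max *+ (b == ord_max).
Proof.
rewrite -mulmxE mxE (bigD1 ord_max) //= big1 ?addr0 => [|c neq_c].
  by rewrite mxE eqxx mulr_natr.
by rewrite mxE (negPf neq_c) mulr0.
Qed.

(** Block diagonal matrices commute with the projection [E] to the last coordinate; this is how the
    group [K] enters below. *)
Lemma in_K_comm (k : 'M[F]_m.+1) : in_K k ->
  [/\ k * E = E * k, k^-1 * E = E * k^-1, k^-1 * k = 1 & k * k^-1 = 1].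
Proof.
case=> k_unit k0; have kE : k * E = E * k.
  apply/matrixP => a b; rewrite mul_unit_projlE mul_unit_projrE.
  have [->|neq_a] := eqVneq a ord_max; have [->|neq_b] := eqVneq b ord_max => //.
    by rewrite (k0 ord_max b) // eqxx (negPf neq_b).
  by rewrite (k0 a ord_max) // eqxx (negPf neq_a).
split; rewrite ?mulVr ?mulrV //.
by apply: (mulIr k_unit); rewrite -!mulrA -kE mulVr // mulr1 mulrA mulVr // mul1r.
Qed.

(** For triangular [z], the product [E * z] (or [z * E], by sign) is a multiple of [E], and
    conjugation by [k] preserves this. *)
Lemma in_Q_border y (a : 'I_m.+1) : B y -> a != ord_max ->
  (if sgn then y ord_max a else y a ord_max) = 0.
Proof.
case: BQ => k [/in_K_comm[kE kVE kVk kkV] By] /By[z [tri_z ->]] neq_a; rewrite -[invmx k]/(k^-1).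
have neq_ltn (b : 'I_m.+1) : b != ord_max -> (b < m)%N.
  move=> neq_b; rewrite ltn_neqAle -ltnS ltn_ord andbT.
  by apply: contraNneq neq_b => eq_b; apply/eqP/val_inj.
have zE : (if sgn then E * z else z * E) = z ord_max ord_max *: E.
  apply/matrixP => i j; rewrite [RHS]mxE [E i j]mxE; case: (sgn) tri_z => tri_z.
    rewrite mul_unit_projlE; case: eqP => _; last by rewrite mulr0.
    have [->|neq_j] := eqVneq j ord_max; first by rewrite mulr1.
    by rewrite mulr0 tri_z //= neq_ltn.
  rewrite mul_unit_projrE andbC; case: eqP => _; last by rewrite mulr0.
  have [->|neq_i] := eqVneq i ord_max; first by rewrite mulr1.
  by rewrite mulr0 tri_z //= neq_ltn.
have kZ : k * (z ord_max ord_max *: E) * k^-1 = z ord_max ord_max *: E.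
  by rewrite -!mulmxE -scalemxAr -scalemxAl !mulmxE kE -mulrA kkV mulr1.
case: (sgn) zE => zE.
  have : (E * (k *m z *m k^-1)) ord_max a = 0.
    rewrite !mulmxE !mulrA -kE -(mulrA k) zE kZ mxE.
    by rewrite mxE eqxx (negPf neq_a) mulr0.
  by rewrite mul_unit_projlE eqxx.
have : ((k *m z *m k^-1) * E) a ord_max = 0.
  rewrite !mulmxE -mulrA kVE mulrA -(mulrA k) zE kZ mxE.
  by rewrite mxE eqxx (negPf neq_a) mulr0.
by rewrite mul_unit_projrE eqxx.
Qed.

Lemma in_Q0 : B 0.
Proof.
case: BQ => k [_ By]; apply/By; exists 0; split; last by rewrite mulmx0 mul0mx.
by move=> a b _; rewrite mxE.
Qed.

(** A change confined to the last column, or row, stays there under conjugation by [k], and a matrix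
    supported there is triangular of the right sign. *)
Lemma in_Q_change_border (y z : 'M[F]_m.+1) : B y ->
    (forall a b : 'I_m.+1, (if sgn then b != ord_max else a != ord_max) -> z a b = y a b) ->
  B z.
Proof.
case: BQ => k [/in_K_comm[kE kVE kVk kkV] By] /By[y' [tri_y' def_y]] eq_zy.
pose W := k^-1 * (z - y) * k; apply/By; exists (y' + W); split; last first.
  rewrite -[invmx k]/(k^-1) mulmxDr mulmxDl -def_y !mulmxE /W !mulrA kkV mul1r.
  by rewrite -mulrA kkV mulr1 addrC subrK.
have zyE : (if sgn then (z - y) * E else E * (z - y)) = z - y.
  apply/matrixP => a b; case: (sgn) eq_zy => eq_zy.
    rewrite mul_unit_projrE; have [->|neq_b] := eqVneq b ord_max; first by [].
    by rewrite !mxE (eq_zy a b) // subrr.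
  rewrite mul_unit_projlE; have [->|neq_a] := eqVneq a ord_max; first by [].
  by rewrite !mxE (eq_zy a b) // subrr.
have WE : (if sgn then W * E else E * W) = W.
  case: (sgn) zyE => zyE; rewrite /W.
    by rewrite -mulrA kE mulrA -(mulrA k^-1) zyE.
  by rewrite !mulrA -kVE -(mulrA k^-1 E) zyE.
move=> a b lt_ab; rewrite mxE tri_y' // add0r -WE.
have lt_neq (i j : 'I_m.+1) : (i < j)%N -> i != ord_max.
  move=> lt_ij; apply: contraTneq lt_ij => ->.
  by rewrite -leqNgt /= -ltnS.
case: (sgn) lt_ab => lt_ab.
  by rewrite mul_unit_projrE (negPf (lt_neq _ _ lt_ab)).
by rewrite mul_unit_projlE (negPf (lt_neq _ _ lt_ab)).
Qed.

End BorelOrbits.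

(** * The Borel subalgebra of a sign sequence and its derived algebra *)

Section BorelSequence.
Variables (F : numFieldType) (n : nat).
Implicit Types (x : 'M[F]_n.+1) (s : 'I_n -> bool).

Definition nat_sign s (k : nat) : bool :=
  if k is k'.+1 then odflt true (omap s (insub k')) else true.

Lemma nat_signS s (i : 'I_n) : nat_sign s i.+1 = s i.
Proof. by rewrite /= valK. Qed.

Variables (s : 'I_n -> bool) (b : 'M[F]_n.+1 -> Prop).
Hypothesis bQ : @is_bQ F n.+1 s b.

Let t := nat_sign s.

Let widen_max (i : 'I_n.+1) : widen_ord (ltn_ord i) ord_max = i.
Proof. exact: val_inj. Qed.

Lemma bQ_border x (i a : 'I_n.+1) : b x -> (a < i)%N ->
  (if t i then x i a else x a i) = 0.
Proof.
move=> bx lt_ai; have Bx : proj_set i b (trunc i x) by exists x.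
pose a' : 'I_i.+1 := Ordinal (ltnW lt_ai : (a < i.+1)%N).
have wa : widen_ord (ltn_ord i) a' = a by apply: val_inj.
have neq_a' : a' != ord_max by rewrite -val_eqE /= ltn_eqF.
have := in_Q_border (bQ i) Bx neq_a'; rewrite !mxE widen_max wa.
exact.
Qed.

(** [b] is known only through its projections. For the converse, an element of [b] agreeing with [x]
    on the corner of size [k] is replaced by one agreeing on size [k.+1], until the whole of [x] is
    reached. *)
Lemma bQ_weak_tri x : b x <-> weak_tri t x.
Proof.
split=> [bx a c|x0].
  rewrite -prec_pos /prec; case: ltngtP => //= lt_ac ta.
    by have := bQ_border bx lt_ac; rewrite ta.
  by have := bQ_border bx lt_ac; rewrite (negPf ta).
suff H (k : nat) : (k <= n.+1)%N -> exists w, b w /\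
    forall a c : 'I_n.+1, (a < k)%N -> (c < k)%N -> w a c = x a c.
  have [w [bw wx]] := H n.+1 (leqnn _).
  by have -> : x = w by apply/matrixP => a c; rewrite wx.
elim: k => [|k IHk] lt_kn.
  by have [w [bw _]] := in_Q0 (bQ ord0); exists w.
have [w [bw wx]] := IHk (ltnW lt_kn); pose i := Ordinal lt_kn.
have Bw : proj_set i b (trunc i w) by exists w.
have [|w' [bw' xw']] := @in_Q_change_border _ _ _ _ (bQ i) _ (trunc i x) Bw.
  move=> a c neq_ac; rewrite !mxE; apply/esym.
  set a' := widen_ord _ a; set c' := widen_ord _ c.
  (* One border may be changed freely, together with the diagonal entry; on the opposite border both
     [w] and [x] vanish. *)
  have [lt_ak|le_ka] := ltnP a k; have [lt_ck|le_kc] := ltnP c k; first exact: wx.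
  - have ci : c' = i by apply/val_inj/eqP; rewrite eqn_leq /= le_kc -ltnS ltn_ord.
    have cM : c == ord_max by rewrite -val_eqE /= eqn_leq le_kc -ltnS ltn_ord.
    rewrite cM -[@Qsign n.+1 s i]/(t i) in neq_ac; have ti : ~~ t i by case: (t i) neq_ac.
    have := @bQ_border w i a' bw lt_ak; rewrite (negPf ti) ci => ->.
    by rewrite x0 // -prec_pos /prec /= ltnNge (ltnW lt_ak) /= lt_ak.
  - have ai : a' = i by apply/val_inj/eqP; rewrite eqn_leq /= le_ka -ltnS ltn_ord.
    have aM : a == ord_max by rewrite -val_eqE /= eqn_leq le_ka -ltnS ltn_ord.
    rewrite aM -[@Qsign n.+1 s i]/(t i) in neq_ac; have ti : t i by case: (t i) neq_ac.
    have := @bQ_border w i c' bw lt_ck; rewrite ti ai => ->.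
    by rewrite x0 // -prec_pos /prec /= lt_ck.
  have aM : a == ord_max by rewrite -val_eqE /= eqn_leq le_ka -ltnS ltn_ord.
  have cM : c == ord_max by rewrite -val_eqE /= eqn_leq le_kc -ltnS ltn_ord.
  by move: neq_ac; rewrite aM cM; case: (@Qsign n.+1 s i).
exists w'; split=> // a c lt_ak lt_ck.
move/matrixP/(_ (Ordinal lt_ak) (Ordinal lt_ck)): xw'; rewrite !mxE.
have -> : widen_ord (ltn_ord i) (Ordinal lt_ak) = a by apply: val_inj.
by have -> : widen_ord (ltn_ord i) (Ordinal lt_ck) = c by apply: val_inj.
Qed.

(** Diagonal entries of products of triangular matrices multiply, so they cancel in commutators.
    Conversely one commutator with a diagonal matrix is enough. *)
Lemma bQ_derived x : derived b x <-> strict_tri t x.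
Proof.
split=> [[k [ys [zs [byz ->]]]]|xt].
  apply/strict_triP => a c le_ca; rewrite summxE big1 // => i _.
  have [/bQ_weak_tri y0 /bQ_weak_tri z0] := byz i.
  have mulE y z : weak_tri t y -> weak_tri t z ->
      (y *m z) a c = (y a a * z a a) *+ (a == c).
    move=> y0' z0'; rewrite mxE; have [eq_ac|neq_ac] := eqVneq a c.
      rewrite -eq_ac (bigD1 a) //= big1 ?addr0 // => d neq_da.
      have [lt_da|le_ad] := ltnP (pos t d) (pos t a); first by rewrite y0' ?mul0r.
      rewrite z0' ?mulr0 // ltn_neqAle le_ad andbT.
      by apply: contra_neq neq_da => /pos_inj.
    have lt_ca : (pos t c < pos t a)%N.
      by rewrite ltn_neqAle le_ca andbT; apply: contra_neq neq_ac => /pos_inj.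
    rewrite big1 // => d _.
    have [lt_da|le_ad] := ltnP (pos t d) (pos t a); first by rewrite y0' ?mul0r.
    by rewrite z0' ?mulr0 // (leq_trans lt_ca).
  by rewrite mxE [X in _ + X]mxE !mulE // mulrC subrr.
(* [h] has distinct diagonal entries, so its bracket scales the entry [(a, c)] by [a - c], nonzero
   off the diagonal. On the diagonal [y] divides by zero and gets 0, consistent with [x a a = 0]. *)
pose h : 'M[F]_n.+1 := diag_mx (\row_a (a : nat)%:R).
pose y : 'M[F]_n.+1 := \matrix_(a, c) (x a c / (a%:R - c%:R)).
exists 1%N, (fun=> h), (fun=> y); split=> [_|].
  split; apply/bQ_weak_tri => a c lt_ca; rewrite !mxE.
    by case: eqP lt_ca => // ->; rewrite ltnn.
  by move/strict_weak: xt => ->; rewrite ?mul0r.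
rewrite big_ord_recl big_ord0 addr0; apply/matrixP => a c.
rewrite /h mul_diag_mx mul_mx_diag !mxE mulrC -mulrBr.
have [<-|neq_ac] := eqVneq a c.
  by rewrite subrr mulr0 xt // prec_irr.
by rewrite divfK // subr_eq0 eqr_nat.
Qed.

Lemma bQ_nreg x : nreg b x <-> strict_tri t x /\ x ^+ n != 0.
Proof.
rewrite /nreg bQ_derived; split=> -[xt]; by move/(strict_tri_regular xt).
Qed.

End BorelSequence.

(** * Zariski closed sets and irreducibility *)

Section Zariski.
Variables (F : numFieldType) (n : nat).
Implicit Types (x y : 'M[F]_n.+1) (Y Z : 'M[F]_n.+1 -> Prop).

Lemma polyfun_line (f : 'M[F]_n.+1 -> F) x y : polyfun f ->
  exists q : {poly F}, forall u, f (x + u *: y) = q.[u].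
Proof.
elim=> [c|a b|g h _ [q gq] _ [r hr]|g h _ [q gq] _ [r hr]].
- by exists c%:P => u; rewrite hornerC.
- exists ((x a b)%:P + 'X * (y a b)%:P) => u.
  by rewrite !mxE hornerD hornerM hornerX !hornerC.
- by exists (q + r) => u; rewrite gq hr hornerD.
- by exists (q * r) => u; rewrite gq hr hornerM.
Qed.

Lemma exp_line x y (k : nat) (a b : 'I_n.+1) :
  exists q : {poly F}, forall u, ((x + u *: y) ^+ k) a b = q.[u].
Proof.
pose M : 'M[{poly F}]_n.+1 := \matrix_(a, b) ((x a b)%:P + 'X * (y a b)%:P).
exists ((M ^+ k) a b) => u; elim: k b => [|k IHk] b.
  by rewrite !expr0 !mxE; case: eqP => _; rewrite ?hornerC ?horner0.
rewrite !exprSr -!mulmxE !mxE horner_sum; apply: eq_bigr => c _.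
by rewrite hornerM IHk !mxE hornerD hornerM hornerX !hornerC.
Qed.

Lemma exists_nonroot (p : {poly F}) : p != 0 -> exists u, p.[u] != 0.
Proof.
(* In characteristic zero these are [size p] distinct points, more than [p] has roots. *)
move=> p_neq0; pose rs : seq F := [seq i%:R | i <- iota 0 (size p)].
have: ~~ all (root p) rs.
  apply/negP => /(max_poly_roots p_neq0); rewrite size_map size_iota ltnn => /implyP.
  rewrite implybF; case/negP; rewrite map_inj_in_uniq ?iota_uniq // => i j _ _ /eqP.
  by rewrite eqr_nat => /eqP.
by case/allPn => u _; exists u.
Qed.

Lemma zariski_closed0 : zariski_closed (fun _ : 'M[F]_n.+1 => False).
Proof.
exists (fun f => f = (fun=> 1)); split=> [f ->|x]; first exact: polyfun_const.
by split=> // /(_ _ erefl)/eqP; rewrite oner_eq0.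
Qed.

Lemma zariski_closedU Z1 Z2 : zariski_closed Z1 -> zariski_closed Z2 ->
  zariski_closed (fun x => Z1 x \/ Z2 x).
Proof.
case=> S1 [polyS1 ZS1] [S2 [polyS2 ZS2]].
exists (fun f => exists g h, [/\ S1 g, S2 h & f = (fun x => g x * h x)]).
split=> [f [g [h [/polyS1 ? /polyS2 ? ->]]]|x]; first exact: polyfun_mul.
split=> [Z12 f [g [h [Sg Sh ->]]]|Z12].
  by case: Z12 => [/ZS1/(_ _ Sg) ->|/ZS2/(_ _ Sh) ->]; rewrite ?mul0r ?mulr0.
case: (classic (Z1 x)) => [|nZ1]; [by left | right; apply/ZS2 => h Sh].
apply/eqP; apply: contraT => hx_neq0; case: nZ1; apply/ZS1 => g Sg.
have /eqP := Z12 _ (ex_intro _ g (ex_intro _ h (And3 Sg Sh erefl))).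
by rewrite mulf_eq0 (negPf hx_neq0) orbF => /eqP.
Qed.

(** Finite unions of closed sets are closed, so the property for two sets extends by induction on
    the list. *)
Lemma irreducible_cover (I : eqType) (r : seq I) (Z : I -> 'M[F]_n.+1 -> Prop) Y :
    irreducible Y -> (forall i, zariski_closed (Z i)) ->
    (forall y, Y y -> exists2 i, i \in r & Z i y) ->
  exists2 i, i \in r & forall y, Y y -> Z i y.
Proof.
move=> [[y0 Yy0] irrY] clZ; have clU (r' : seq I) :
    zariski_closed (fun y => exists2 i, i \in r' & Z i y).
  elim: r' => [|i r' [S [polyS ZS]]].
    have [S [polyS ZS]] := zariski_closed0; exists S; split=> // x.
    by rewrite -ZS; split=> [[]|].
  have [T [polyT ZT]] := zariski_closedU (clZ i) (ex_intro _ S (conj polyS ZS)).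
  exists T; split=> // x; rewrite -ZT; split=> [[j]|[Zi|[j r'j Zj]]].
  - by rewrite inE => /predU1P[->|r'j] Zj; [left | right; exists j].
  - by exists i; rewrite ?mem_head.
  - by exists j; rewrite // inE r'j orbT.
elim: r => [|i r IHr] cov; first by have [] := cov _ Yy0.
have [|Zi|Zr] := irrY _ _ (clZ i) (clU r).
- move=> y /cov[j]; rewrite inE => /predU1P[->|rj] Zj; [by left | by right; exists j].
- by exists i; rewrite ?mem_head.
- by have [j rj Zj] := IHr Zr; exists j; rewrite // inE rj orbT.
Qed.

Variable t : nat -> bool.

Lemma zariski_closed_strict_tri : zariski_closed (fun x => strict_tri t x).
Proof.
exists (fun f => exists a b : 'I_n.+1, ~~ prec t a b /\ f = (fun x => x a b)).
split=> [f [a [b [_ ->]]]|x]; first exact: polyfun_coord.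
split=> [x0 f [a [b [ab ->]]]|x0 a b ab]; first exact: x0.
by apply: (x0 (fun x => x a b)); exists a, b.
Qed.

(* A line through two points of the linear space of strictly triangular matrices
   meets any two nonempty open subsets through these points, and [x ^+ n != 0],
   in cofinite sets. *)
Lemma irreducible_strict_tri_reg :
  irreducible (fun x => strict_tri t x /\ x ^+ n != 0).
Proof.
split; first exact: exists_strict_tri_reg.
move=> Z1 Z2 [S1 [polyS1 ZS1]] [S2 [polyS2 ZS2]] cov.
have outside S Z : (forall f, S f -> polyfun f) ->
    (forall x, Z x <-> (forall f, S f -> f x = 0)) ->
    ~ (forall y, strict_tri t y /\ y ^+ n != 0 -> Z y) ->
    exists f y, [/\ polyfun f, forall x, Z x -> f x = 0, strict_tri t y, y ^+ n != 0 & f y != 0].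
  move=> polyS ZS nYZ; have [y nZy] := not_all_ex_not _ _ nYZ.
  have [[yt yn] {}nZy] := imply_to_and _ _ nZy.
  have nfy : ~ (forall f, S f -> f y = 0) by move/ZS.
  have [f nf] := not_all_ex_not _ _ nfy; have [Sf fy] := imply_to_and _ _ nf.
  by exists f, y; split=> //; [apply: polyS | move=> x /ZS; apply | apply/eqP].
case: (classic (forall y, strict_tri t y /\ y ^+ n != 0 -> Z1 y)); first by left.
move=> /(outside _ _ polyS1 ZS1)[f1 [y1 [poly1 Zf1 y1t y1n f1y1]]].
case: (classic (forall y, strict_tri t y /\ y ^+ n != 0 -> Z2 y)); first by right.
move=> /(outside _ _ polyS2 ZS2)[f2 [y2 [poly2 Zf2 y2t y2n f2y2]]].
exfalso; pose d := y2 - y1.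
have [q1 q1E] := @polyfun_line f1 y1 d poly1.
have [q2 q2E] := @polyfun_line f2 y1 d poly2.
have [a [b y1ab]] : exists a b, (y1 ^+ n) a b != 0.
  apply: NNPP => no_ab; case/eqP: y1n; apply/matrixP => a b; rewrite mxE.
  by apply/eqP; apply: contraT => ab; case: no_ab; exists a, b.
have [q3 q3E] := @exp_line y1 d n a b.
have nz (q : {poly F}) u : q.[u] != 0 -> q != 0 by apply: contraNneq => ->; rewrite horner0.
have [u] : exists u, (q1 * q2 * q3).[u] != 0.
  apply: exists_nonroot; rewrite !mulf_neq0 //.
  - by apply: (@nz _ 0); rewrite -q1E scale0r addr0.
  - by apply: (@nz _ 1); rewrite -q2E scale1r addrC subrK.
  - by apply: (@nz _ 0); rewrite -q3E scale0r addr0.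
rewrite !hornerM !mulf_eq0 !negb_or -q1E -q2E -q3E => /andP[/andP[nz1 nz2] nz3].
have [|/Zf1 z1|/Zf2 z2] := cov (y1 + u *: d).
- split; last by apply: contraNneq nz3 => ->; rewrite mxE.
  by move=> i j ij; rewrite !mxE y1t // y2t // subrr mulr0 addr0.
- by rewrite z1 eqxx in nz1.
- by rewrite z2 eqxx in nz2.
Qed.

End Zariski.

(** The order reads [t] only at the larger of two distinct indices, hence at values from 1 to [n],
    which a sequence of [n] signs records. *)
Lemma strict_tri_nat_sign (F : numFieldType) (n : nat) (t : nat -> bool) (x : 'M[F]_n.+1) :
  strict_tri t x -> strict_tri (nat_sign (fun i : 'I_n => t i.+1)) x.
Proof.
move=> xt a b; have signE (k : nat) : (0 < k)%N -> (k <= n)%N ->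
    nat_sign (fun i : 'I_n => t i.+1) k = t k.
  by case: k => // k _ lt_kn; rewrite -[k]/(nat_of_ord (Ordinal lt_kn)) nat_signS.
move=> ab; apply: xt; move: ab; rewrite /prec.
by case: ltngtP => //= lt_ab; rewrite signE //; try exact: leq_ltn_trans lt_ab;
  exact: (ltnSE (ltn_ord _)).
Qed.

Theorem theorem4p5 (R : realType) (n : nat) (n_ge1 : (1 <= n)%N)
  (bQ : ('I_n -> bool) -> 'M[R[i]]_n.+1 -> Prop)
  (hbQ : forall s, @is_bQ R[i] n.+1 s (bQ s)) :
  (* (a) *)
  (forall x, Phi_zero_sreg x -> exists s, bQ s x) /\
  (* (b) the union *)
  (forall x, Phi_zero_sreg x <-> exists s, nreg (bQ s) x) /\
  (* disjointness *)
  (forall s s', s <> s' -> forall x, nreg (bQ s) x -> ~ nreg (bQ s') x) /\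
  (* each n_Q^reg is an irreducible component *)
  (forall s, irreducible_component (@Phi_zero_sreg R[i] n.+1) (nreg (bQ s))) /\
  (* every irreducible component is of this form *)
  (forall Y, irreducible_component (@Phi_zero_sreg R[i] n.+1) Y ->
     exists s, forall x, Y x <-> nreg (bQ s) x).
Proof.
have nregE s x : nreg (bQ s) x <-> strict_tri (nat_sign s) x /\ x ^+ n != 0.
  exact: (bQ_nreg (hbQ s)).
have sregE x : Phi_zero_sreg x <-> exists s, nreg (bQ s) x.
  rewrite (@sregP R[i] n x) nestedP; split=> [[[t xt] xn]|[s /nregE[xt xn]]].
    by exists (fun i => t i.+1); apply/nregE; split=> //; apply: strict_tri_nat_sign.
  by split=> //; exists (nat_sign s).
(* Asking only triangularity for [s'] serves both disjointness and the maximality of components. *)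
have disj s s' x : nreg (bQ s) x -> strict_tri (nat_sign s') x -> s = s'.
  move=> /nregE[xt xn] xt'; apply: functional_extensionality => i.
  by rewrite -!nat_signS; apply: (strict_tri_order xt xt' xn).
have irr s : irreducible (nreg (bQ s)).
  have [[y yV] irrV] := @irreducible_strict_tri_reg R[i] n (nat_sign s).
  split=> [|Z1 Z2 clZ1 clZ2 cov]; first by exists y; apply/nregE.
  have [y' /nregE/cov //|Z|Z] := irrV Z1 Z2 clZ1 clZ2.
    by left=> y' /nregE/Z.
  by right=> y' /nregE/Z.
have inside Y : irreducible Y -> (forall y, Y y -> Phi_zero_sreg y) ->
    exists s, forall y, Y y -> nreg (bQ s) y.
  (* Finite functions make the sequences enumerable. The closed linear spaces cover [Y], so one
     contains it; [x ^+ n != 0] comes from strong regularity. *)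
  move=> irrY YX; pose Z (s : {ffun 'I_n -> bool}) (x : 'M[R[i]]_n.+1) := strict_tri (nat_sign s) x.
  have clZ s : zariski_closed (Z s) by exact: zariski_closed_strict_tri.
  have [y /YX/sregE[s /nregE[yt _]]|s _ YZ] := irreducible_cover (r := enum {: {ffun 'I_n -> bool}}) irrY clZ.
    exists (finfun s); rewrite ?mem_enum // /Z.
    by have -> : (finfun s : 'I_n -> bool) = s by apply: functional_extensionality => i; rewrite ffunE.
  exists s => y Yy; apply/nregE; split; first exact: YZ.
  by have /sregE[s' /nregE[]] := YX _ Yy.
split; first by move=> x /sregE[s /nregE[xt _]]; exists s; apply/(bQ_weak_tri (hbQ s))/strict_weak.
split=> //; split.
  by move=> s s' neq x xs /nregE[xs' _]; apply: neq; apply: (disj _ _ x).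
split=> [s|Y [YX [irrY maxY]]].
  split; first by move=> y ys; apply/sregE; exists s.
  split=> // Y sY YX irrY; have [s' Ys'] := inside Y irrY YX.
  have [[y ys] _] := irr s.
  (* A single point of the piece of [s] lying in the piece of [s'] already forces [s = s']. *)
  by have /nregE[yt' _] := Ys' _ (sY _ ys); rewrite (disj _ _ y ys yt').
have [s Ys] := inside Y irrY YX; exists s => x; split; first exact: Ys.
by apply: (maxY _ Ys) => // y ys; apply/sregE; exists s.
Qed.
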